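(* Let $X$ be a set of $n\ge 2$ points in sufficiently general position in $\mathbb{P}^1\times\mathbb{P}^1$, and let $(i,i')$ be a minimal element (with respect to $\preceq$) of $\operatorname{reg}(S/I_X)$ with $i\le i'$. If $i(i'+2)>n$ and $3n-3ii'-2i-2i'<0$, then the virtual resolution of the pair $(S/I_X,(i,i'))$ has length three.
   Context: Let $k$ be an algebraically closed field of arbitrary characteristic and $S=k[x_0,x_1,y_0,y_1]$ the Cox ring of $\mathbb{P}^1\times\mathbb{P}^1$, $\mathbb{Z}^2$-graded by $\deg x_j=(1,0)$, $\deg y_j=(0,1)$. The irrelevant ideal is $B=\langle x_0,x_1\rangle\cap\langle y_0,y_1\rangle$. $\mathbb{N}$ includes $0$. On $\mathbb{Z}^2$, $(i,i')\preceq(j,j')$ means $i\le j$ and $i'\le j'$. For a finite set of points $X\subseteq\mathbb{P}^1\times\mathbb{P}^1$, $I_X\subseteq S$ is the bihomogeneous ideal of forms vanishing on $X$ (it is $B$-saturated). Hilbert function and differences: $H_X(i,i')=\dim_k (S/I_X)_{(i,i')}$ for $(i,i')\in\mathbb{N}^2$; write $m_{i,i'}=H_X(i,i')$, $c_{i,i'}=m_{i,i'}+m_{i-1,i'-1}-m_{i,i'-1}-m_{i-1,i'}$, and $d_{i,i'}=c_{i,i'}+c_{i-1,i'-1}-c_{i,i'-1}-c_{i-1,i'}$, entries with a negative index being $0$. The matrix $\Delta^2H_X=(d_{i,i'})$ is the second difference function. $X$ has a generic Hilbert function if $H_X(i,i')=\min\{|X|,(i+1)(i'+1)\}$ for all $(i,i')\in\mathbb{N}^2$.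 Betti numbers: $\beta_{p,(r,r')}$ is the number of summands $S(-r,-r')$ in homological degree $p$ of the $\mathbb{Z}^2$-graded minimal free resolution of $S/I_X$. Sufficiently general position: by a known theorem of Giuffrida, Maggioni and Ragusa, for each $n\ge1$ there is a dense open subset $U\subseteq(\mathbb{P}^1\times\mathbb{P}^1)^n$ such that for every $(P_1,\dots,P_n)\in U$ the set $X=\{P_1,\dots,P_n\}$ satisfies: (1) $X$ has a generic Hilbert function; (2) the nonzero $\beta_{1,(r,r')}$ are precisely given by $\beta_{1,(r,r')}=-d_{r,r'}$ for the entries $d_{r,r'}<0$ such that either $d_{r,s'}>0$ for some $s'>r'$ or $d_{s,r'}>0$ for some $s>r$. A set $X$ of $n$ points $P_1,\dots,P_n$ is in sufficiently general position if $(P_1,\dots,P_n)\in U$. Multigraded regularity: a $\mathbb{Z}^2$-graded $S$-module $M$ is $r$-regular, $r\in\mathbb{Z}^2$, if (1) $H^j_B(M)_p=0$ for all $j\ge1$ and all $p\in\bigcup(r-\lambda+\mathbb{N}^2)$, the union over $\lambda=(\lambda_1,\lambda_2)\in\mathbb{N}^2$ with $\lambda_1+\lambda_2=j-1$; and (2) $H^0_B(M)_p=0$ for all $p\in(r+(1,0)+\mathbb{N}^2)\cup(r+(0,1)+\mathbb{N}^2)$. Set $\operatorname{reg}(M)=\{r\in\mathbb{Z}^2: M\text{ is } r\text{-regular}\}$. Virtual resolution of a pair: for $(i,i')\in\operatorname{reg}(S/I_X)$, the virtual resolution of the pair $(S/I_X,(i,i'))$ is the subcomplex of the $\mathbb{Z}^2$-graded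 minimal free resolution of $S/I_X$ consisting of all summands $S(-a,-a')$ with $(a,a')\preceq(i+1,i'+1)$. The length of a complex $0\leftarrow F_0\leftarrow F_1\leftarrow\cdots$ is the largest $p$ with $F_p\ne0$. *)

(* Defs.v *)
From HB Require Import structures.
From mathcomp Require Import all_boot all_order all_algebra.
From mathcomp Require Import boolp mpoly.
Set Implicit Arguments.
Unset Strict Implicit.
Unset Printing Implicit Defensive.
Import Order.TTheory GRing.Theory Num.Theory.
Local Open Scope ring_scope.

(* The Cox ring S = k[x_0, x_1, y_0, y_1]: the variables are indexed by
   'I_(2 + 2), with x_j = 'X_(lshift 2 j) and y_j = 'X_(rshift 2 j). *)
Notation cox k := {mpoly k[2 + 2]}.

Definition bideg (m : 'X_{1..2 + 2}) : int * int :=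
  ((\sum_(j < 2) m (lshift 2 j))%N%:Z, (\sum_(j < 2) m (rshift 2 j))%N%:Z).

Definition bihomog (k : closedFieldType) (d : int * int) (f : cox k) : bool :=
  all (fun m => bideg m == d) (msupp f).

Definition lez2 (p q : int * int) : bool := (p.1 <= q.1) && (p.2 <= q.2).

Record gmodule (k : closedFieldType) := GModule {
  gm_sort :> lmodType (cox k);
  gm_part : int * int -> gm_sort -> Prop;
  gm_part0 : forall d, gm_part d 0;
  gm_partB : forall d u v, gm_part d u -> gm_part d v -> gm_part d (u - v);
  gm_partZ : forall d e f u,
    bihomog d f -> gm_part e u -> gm_part (d + e) (f *: u);
  gm_decomp : forall u, exists (s : seq (int * int)) (c : int * int -> gm_sort),
    (forall d, gm_part d (c d)) /\ u = \sum_(d <- s) c d;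
  gm_direct : forall (s : seq (int * int)) (c : int * int -> gm_sort),
    uniq s -> (forall d, gm_part d (c d)) -> \sum_(d <- s) c d = 0 ->
    forall d, d \in s -> c d = 0
}.

Definition part_has_dim (k : closedFieldType) (M : gmodule k) (d : int * int)
    (N : nat) : Prop :=
  exists e : 'I_N -> M,
    [/\ forall i, gm_part d (e i),
        forall c : 'I_N -> k, \sum_i (c i)%:MP *: e i = 0 -> forall i, c i = 0
      & forall u, gm_part d u ->
          exists c : 'I_N -> k, u = \sum_i (c i)%:MP *: e i].

(* The k-dimension of M_d; the junk value is 0 when M_d is infinite-dimensional. *)
Definition part_dim (k : closedFieldType) (M : gmodule k) (d : int * int) : nat :=
  if pselect (exists N, part_has_dim M d N) is left h then projT1 (cid h) else 0%N.

(* P^1 is the set of lines through the origin of k^2. *)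
Record P1 (k : closedFieldType) := MkP1 {
  line :> {vspace 'rV[k]_2};
  _ : \dim line == 1%N
}.
HB.instance Definition _ (k : closedFieldType) := [isSub for @line k].
HB.instance Definition _ (k : closedFieldType) := [Equality of P1 k by <:].

Definition P1xP1 (k : closedFieldType) : eqType := (P1 k * P1 k)%type.

Definition vanishes_at (k : closedFieldType) (f : cox k) (p : P1xP1 k) : Prop :=
  forall u v : 'rV[k]_2, u != 0 -> v != 0 -> u \in line p.1 -> v \in line p.2 ->
  f.@[row_mx u v ord0] = 0.

Definition form_vanishing_on (k : closedFieldType) (X : seq (P1xP1 k))
    (f : cox k) : Prop :=
  (exists d, bihomog d f) /\ forall p, p \in X -> vanishes_at f p.

Definition IX (k : closedFieldType) (X : seq (P1xP1 k)) : {pred cox k} :=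
  fun f => `[< exists (r : nat) (g h : 'I_r -> cox k),
    (forall l, form_vanishing_on X (h l)) /\ f = \sum_l g l * h l >].

Section QuotientModule.
Variables (k : closedFieldType) (X : seq (P1xP1 k)).
Implicit Types (f g : cox k) (d e : int * int).

Lemma IX_zmod_closed : zmod_closed (IX X).
Proof.
split=> [|f g].
  apply/asboolP; exists 0%N, (fun=> 0), (fun=> 0); split; first by case.
  by rewrite big_ord0.
move=> /asboolP[r [a [h [hV ->]]]] /asboolP[s [b [h' [hV' ->]]]].
apply/asboolP; exists (r + s)%N.
exists (fun l => match split l with inl i => a i | inr j => - b j end).
exists (fun l => match split l with inl i => h i | inr j => h' j end); split.
  by move=> l; case: (split l).
rewrite big_split_ord /=; congr (_ + _).
  by apply: eq_bigr => i _; rewrite (unsplitK (inl i)).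
rewrite -sumrN; apply: eq_bigr => i _.
by rewrite (unsplitK (inr i)) mulNr.
Qed.

HB.instance Definition _ := GRing.isZmodClosed.Build (cox k) (IX X) IX_zmod_closed.

Lemma IX_mull f g : g \in IX X -> f * g \in IX X.
Proof.
move=> /asboolP[r [a [h [hV ->]]]].
apply/asboolP; exists r, (fun l => f * a l), h; split=> //.
by rewrite big_distrr /=; apply: eq_bigr => i _; rewrite mulrA.
Qed.

Definition hcomp d f : cox k :=
  \sum_(m <- msupp f | bideg m == d) f@_m *: 'X_[m].

Lemma mcoeff_hcomp d f m : (hcomp d f)@_m = if bideg m == d then f@_m else 0.
Proof.
rewrite /hcomp raddf_sum /= big_mkcond /=.
rewrite (eq_bigr (fun m' => (if bideg m == d then f@_m' else 0) * (m' == m)%:R)).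
  have [mf|mf] := boolP (m \in msupp f).
    rewrite (bigD1_seq m) //= ?msupp_uniq // eqxx mulr1 big1 ?addr0 //.
    by move=> m' /negPf->; rewrite mulr0.
  rewrite big_seq big1 => [|m' m'f].
    by move/memN_msupp_eq0: mf => ->; rewrite if_same.
  by rewrite (negPf (memPn mf _ m'f)) mulr0.
move=> m' _; rewrite mcoeffZ mcoeffX.
by have [->|_] := eqVneq m' m; rewrite ?mulr1 ?mulr0 ?if_same.
Qed.

Lemma hcomp_is_zmod_morphism d : zmod_morphism (hcomp d).
Proof.
move=> f g; apply/mpolyP => m; rewrite mcoeffB !mcoeff_hcomp mcoeffB.
by case: ifP => // _; rewrite subr0.
Qed.
HB.instance Definition _ d :=
  GRing.isZmodMorphism.Build (cox k) (cox k) (hcomp d) (hcomp_is_zmod_morphism d).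

Lemma bihomogP d f :
  reflect (forall m, f@_m != 0 -> bideg m = d) (bihomog d f).
Proof.
apply: (iffP allP) => [h m|h m]; rewrite -?mcoeff_msupp; first by move/h/eqP.
by rewrite mcoeff_msupp => /h ->.
Qed.

Lemma hcomp_bihomog d e f : bihomog e f -> hcomp d f = if e == d then f else 0.
Proof.
move/bihomogP=> h; apply/mpolyP => m; rewrite mcoeff_hcomp.
have [fm|fm] := eqVneq f@_m 0.
  by rewrite fm if_same; case: ifP; rewrite ?fm ?mcoeff0.
by rewrite (h _ fm); case: ifP; rewrite ?mcoeff0.
Qed.

Lemma bihomog_hcomp d f : bihomog d (hcomp d f).
Proof.
apply/bihomogP => m; rewrite mcoeff_hcomp.
by have [->|_] := eqVneq (bideg m) d; rewrite ?eqxx.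
Qed.

Lemma bidegD m m' : bideg (m + m')%MM = bideg m + bideg m'.
Proof.
by congr pair; rewrite -PoszD -big_split /=; congr Posz; apply: eq_bigr => j _;
  rewrite mnmDE.
Qed.

Lemma bihomogM d e f g : bihomog d f -> bihomog e g -> bihomog (d + e) (f * g).
Proof.
move=> /allP hf /allP hg; apply/allP => m /msuppM_le /allpairsP[[a b] /= [fa gb ->]].
by rewrite bidegD (eqP (hf _ fa)) (eqP (hg _ gb)).
Qed.

Lemma bihomogB d f g : bihomog d f -> bihomog d g -> bihomog d (f - g).
Proof.
move=> /bihomogP hf /bihomogP hg; apply/bihomogP => m; rewrite mcoeffB.
have [fm|/hf //] := eqVneq f@_m 0.
by rewrite fm sub0r oppr_eq0; apply: hg.
Qed.

Lemma bihomog0 d : bihomog d (0 : cox k).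
Proof. by apply/bihomogP => m; rewrite mcoeff0 eqxx. Qed.

Lemma hcomp_sum f :
  f = \sum_(d <- undup (map bideg (msupp f))) hcomp d f.
Proof.
apply/mpolyP => m; rewrite raddf_sum /=.
have [mf|mf] := boolP (m \in msupp f).
  rewrite (bigD1_seq (bideg m)) ?undup_uniq ?mem_undup ?map_f //=.
  rewrite mcoeff_hcomp eqxx big1 ?addr0 // => d.
  by rewrite mcoeff_hcomp eq_sym => /negPf->.
rewrite (memN_msupp_eq0 mf) big1 // => d _.
by rewrite mcoeff_hcomp (memN_msupp_eq0 mf) if_same.
Qed.

Lemma hcompM d e f g : bihomog e g -> hcomp d (f * g) = hcomp (d - e) f * g.
Proof.
move=> hg; have key s : hcomp d ((\sum_(c <- s) hcomp c f) * g) =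
    hcomp (d - e) (\sum_(c <- s) hcomp c f) * g.
  rewrite mulr_suml !raddf_sum /= mulr_suml; apply: eq_bigr => c _.
  rewrite (hcomp_bihomog d (bihomogM (bihomog_hcomp c f) hg)).
  rewrite (hcomp_bihomog (d - e) (bihomog_hcomp c f)) eq_sym -subr_eq eq_sym.
  by case: ifP; rewrite ?mul0r.
by have := key (undup (map bideg (msupp f))); rewrite -hcomp_sum.
Qed.

Lemma IX_hcomp d f : f \in IX X -> hcomp d f \in IX X.
Proof.
move=> /asboolP[r [a [h [hV ->]]]]; rewrite raddf_sum /=.
apply: rpred_sum => l _; have [[e he] _] := hV l.
rewrite (hcompM _ _ he); apply: IX_mull.
apply/asboolP; exists 1%N, (fun=> 1), (fun=> h l); split=> //.
by rewrite big_ord1 mul1r.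
Qed.

Local Open Scope quotient_scope.
Local Notation Q := {ideal_quot IX X}.

Definition quot_scale f (u : Q) : Q := \pi_Q (f * repr u).

Lemma piQ_eq f g : (\pi_Q f = \pi_Q g) <-> f - g \in IX X.
Proof. by rewrite (Quotient.idealrBE (IX X)); split=> [e|/eqP]; first exact/eqP. Qed.

Lemma piQ_eq0 f : \pi_Q f = 0 <-> f \in IX X.
Proof. by rewrite -[f in f \in _]subr0 -piQ_eq raddf0. Qed.

Lemma quot_scale_pi f g : quot_scale f (\pi_Q g) = (\pi_Q (f * g)).
Proof.
apply/piQ_eq; rewrite -mulrBr; apply: IX_mull.
by apply/piQ_eq; rewrite reprK.
Qed.

Lemma quot_scaleA f g u : quot_scale f (quot_scale g u) = quot_scale (f * g) u.
Proof. by elim/quotW: u => h; rewrite (quot_scale_pi g) !quot_scale_pi mulrA. Qed.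

Lemma quot_scale1 : left_id 1 quot_scale.
Proof. by elim/quotW=> h; rewrite quot_scale_pi mul1r. Qed.

Lemma quot_scaleDr : right_distributive quot_scale +%R.
Proof.
move=> f; elim/quotW=> g; elim/quotW=> h.
by rewrite -raddfD !quot_scale_pi mulrDr raddfD.
Qed.

Lemma quot_scaleDl u : {morph quot_scale^~ u : f g / f + g}.
Proof. by elim/quotW: u => h f g; rewrite !quot_scale_pi mulrDl raddfD. Qed.

HB.instance Definition _ := GRing.Zmodule_isLmodule.Build (cox k) Q
  quot_scaleA quot_scale1 quot_scaleDr quot_scaleDl.

Definition quot_part d (u : Q) : Prop :=
  exists2 f : cox k, bihomog d f & u = (\pi_Q f).

Lemma quot_part0 d : quot_part d 0.
Proof. by exists 0; [apply: bihomog0 | rewrite raddf0]. Qed.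

Lemma quot_partB d u v : quot_part d u -> quot_part d v -> quot_part d (u - v).
Proof.
move=> [f hf ->] [g hg ->]; exists (f - g); first exact: bihomogB.
by rewrite raddfB.
Qed.

Lemma quot_partZ d e f u :
  bihomog d f -> quot_part e u -> quot_part (d + e) (f *: u).
Proof.
move=> hf [g hg ->]; exists (f * g); first exact: bihomogM.
exact: quot_scale_pi.
Qed.

Lemma quot_decomp (u : Q) : exists (s : seq (int * int)) (c : int * int -> Q),
  (forall d, quot_part d (c d)) /\ u = \sum_(d <- s) c d.
Proof.
exists (undup (map bideg (msupp (repr u)))).
exists (fun d => \pi_Q (hcomp d (repr u))); split=> [d|].
  by exists (hcomp d (repr u)); first exact: bihomog_hcomp.
by rewrite -[u in LHS]reprK {1}[repr u]hcomp_sum raddf_sum.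
Qed.

Lemma quot_direct (s : seq (int * int)) (c : int * int -> Q) :
  uniq s -> (forall d, quot_part d (c d)) -> \sum_(d <- s) c d = 0 ->
  forall d, d \in s -> c d = 0.
Proof.
move=> us hc; have /choice[f fP] : forall d, exists f : cox k,
    bihomog d f /\ c d = (\pi_Q f).
  by move=> d; have [f] := hc d; exists f.
rewrite (eq_bigr (fun d => \pi_Q (f d))) => [|d _]; last by case: (fP d).
rewrite -raddf_sum => /piQ_eq0 sI d ds.
have [hd ->] := fP d; apply/piQ_eq0.
have := IX_hcomp d sI; rewrite raddf_sum /= (bigD1_seq d) //= big1 ?addr0.
  by rewrite (hcomp_bihomog _ hd) eqxx.
by move=> e /negPf ed; rewrite (hcomp_bihomog _ (fP e).1) ed.
Qed.

Definition coord_ring : gmodule k :=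
  GModule quot_part0 quot_partB quot_partZ quot_decomp quot_direct.

End QuotientModule.

Definition hilb (k : closedFieldType) (X : seq (P1xP1 k)) (i i' : int) : int :=
  if (0 <= i) && (0 <= i') then (part_dim (coord_ring X) (i, i'))%:Z else 0.

Definition diff_op (m : int -> int -> int) (i i' : int) : int :=
  m i i' + m (i - 1) (i' - 1) - m i (i' - 1) - m (i - 1) i'.

Definition hilb_diff2 (k : closedFieldType) (X : seq (P1xP1 k)) :
  int -> int -> int := diff_op (diff_op (hilb X)).

(* |X| is the size of undup X, X being given as a list of points. *)
Definition generic_hilb (k : closedFieldType) (X : seq (P1xP1 k)) : Prop :=
  forall i i' : nat,
    hilb X i%:Z i'%:Z = (minn (size (undup X)) (i.+1 * i'.+1))%:Z.

(* F_p is the free module on the basis gen p; a basis element a spans the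
   summand S(- gdeg a), and d(a) = \sum_b gdiff a b * b. *)
Record gcomplex (k : closedFieldType) := GComplex {
  gen : nat -> finType;
  gdeg : forall p, gen p -> int * int;
  gdiff : forall p, gen p.+1 -> gen p -> cox k;
  gdiff_homog : forall p (a : gen p.+1) (b : gen p),
    bihomog (gdeg a - gdeg b) (gdiff a b);
  gdiff_comp : forall p (a : gen p.+2) (c : gen p),
    \sum_(b : gen p.+1) gdiff a b * gdiff b c = 0
}.

Definition gmap (k : closedFieldType) (F : gcomplex k) (p : nat)
    (v : {ffun gen F p.+1 -> cox k}) : {ffun gen F p -> cox k} :=
  [ffun b => \sum_a v a * gdiff a b].

Definition augment (k : closedFieldType) (F : gcomplex k) (M : gmodule k)
    (eps : gen F 0 -> M) (v : {ffun gen F 0 -> cox k}) : M :=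
  \sum_b v b *: eps b.

Definition min_free_res (k : closedFieldType) (F : gcomplex k) (M : gmodule k) :
    Prop :=
  exists eps : gen F 0 -> M,
    [/\ forall b, gm_part (gdeg b) (eps b),
        forall u : M, exists v, u = augment eps v,
        forall v, augment eps v = 0 <-> exists w, v = @gmap k F 0 w,
        forall p v, @gmap k F p v = 0 <-> exists w, v = @gmap k F p.+1 w
        (* minimality: d(F_(p+1)) lies in <x_0, x_1, y_0, y_1> F_p *)
      & forall p (a : gen F p.+1) (b : gen F p), (gdiff a b)@_0%MM = 0].

Definition betti (k : closedFieldType) (F : gcomplex k) (p : nat)
    (r : int * int) : nat := #|[pred a : gen F p | gdeg a == r]|.

Definition has_length (k : closedFieldType) (F : gcomplex k) (l : nat) : Prop :=
  (0 < #|gen F l|)%N /\ forall p, (l < p)%N -> #|gen F p| = 0%N.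

Section VirtualResolution.
Variables (k : closedFieldType) (F : gcomplex k) (r : int * int).

Definition vres_gen (p : nat) : finType :=
  {a : gen F p | lez2 (gdeg a) (r + (1, 1))}.
Definition vres_deg p (a : vres_gen p) : int * int := gdeg (val a).
Definition vres_diff p (a : vres_gen p.+1) (b : vres_gen p) : cox k :=
  gdiff (val a) (val b).

Lemma vres_diff_homog p (a : vres_gen p.+1) (b : vres_gen p) :
  bihomog (vres_deg a - vres_deg b) (vres_diff a b).
Proof. exact: gdiff_homog. Qed.

Lemma gdiff_out p (a : gen F p.+1) (b : gen F p) :
  lez2 (gdeg a) (r + (1, 1)) -> ~~ lez2 (gdeg b) (r + (1, 1)) -> gdiff a b = 0.
Proof.
move=> /andP[a1 a2] hb; apply/mpolyP => m; rewrite mcoeff0; apply/eqP.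
apply: contraT => nz; have := bihomogP _ _ (gdiff_homog a b) m nz.
move/eqP; rewrite eq_sym subr_eq => /eqP e; case/negP: hb.
move: a1 a2; rewrite e => a1 a2; apply/andP; split.
  by apply: le_trans a1; rewrite lerDr.
by apply: le_trans a2; rewrite lerDr.
Qed.

Lemma vres_diff_comp p (a : vres_gen p.+2) (c : vres_gen p) :
  \sum_(b : vres_gen p.+1) vres_diff a b * vres_diff b c = 0.
Proof.
rewrite -[RHS](gdiff_comp (val a) (val c)).
rewrite [RHS](bigID (fun b => lez2 (gdeg b) (r + (1, 1)))) /=.
rewrite [X in _ = _ + X]big1 ?addr0 => [|b hb]; last first.
  by rewrite (gdiff_out (valP a) hb) mul0r.
rewrite [RHS](reindex_omap (val : vres_gen p.+1 -> _) insub) => [|b hb];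
  last by rewrite insubT.
by apply: eq_bigl => b; rewrite valK eqxx (valP b).
Qed.

Definition vres : gcomplex k := GComplex vres_diff_homog vres_diff_comp.

End VirtualResolution.

(* H^j_B(M) is computed by the Cech complex on the four generators x_a y_b of B, with
   C^j the direct sum of the localizations M_(f_s) over the sets s of j generators,
   f_s being their product.  The pair (m, t) stands for the fraction m / f^t. *)
Section Cech.
Variables (k : closedFieldType) (M : gmodule k).

Definition cech_gen (l : 'I_4) : cox k :=
  let x j : cox k := 'X_(lshift 2 j) in
  let y j : cox k := 'X_(rshift 2 j) in
  tnth [tuple x 0 * y 0; x 0 * y 1; x 1 * y 0; x 1 * y 1] l.

Definition cech_prod (s : {set 'I_4}) : cox k := \prod_(l in s) cech_gen l.

Definition frac_eq (f : cox k) (u v : M * nat) : Prop :=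
  exists t : nat, f ^+ t *: (f ^+ v.2 *: u.1 - f ^+ u.2 *: v.1) = 0.
Definition frac_add (f : cox k) (u v : M * nat) : M * nat :=
  (f ^+ v.2 *: u.1 + f ^+ u.2 *: v.1, (u.2 + v.2)%N).

(* Each x_a y_b has bidegree (1, 1), so f_s has bidegree (#|s|, #|s|). *)
Definition frac_homog (s : {set 'I_4}) (d : int * int) (u : M * nat) : Prop :=
  gm_part (d + (#|s|%:Z, #|s|%:Z) *+ u.2) u.1.

Definition cochain (j : nat) (d : int * int) (c : {set 'I_4} -> M * nat) : Prop :=
  forall s : {set 'I_4}, #|s| = j -> frac_homog s d (c s).

(* The summand of index l is (-1)^|{l' in s, l' < l}| times the image of
   c (s :\ l) under M_(f_(s :\ l)) -> M_(f_s). *)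
Definition cech_diff (c : {set 'I_4} -> M * nat) (s : {set 'I_4}) : M * nat :=
  \big[frac_add (cech_prod s)/(0, 0%N)]_(l in s)
    ((-1) ^+ #|[set l' in s | (l' < l)%N]| *:
       (cech_gen l ^+ (c (s :\ l)).2 *: (c (s :\ l)).1), (c (s :\ l)).2).

(* H^j_B(M)_d = 0; for j = 0 the condition on b is void and cech_diff b is 0. *)
Definition loc_coh_zero (j : nat) (d : int * int) : Prop :=
  forall c, cochain j d c ->
    (forall s : {set 'I_4}, #|s| = j.+1 ->
       frac_eq (cech_prod s) (cech_diff c s) (0, 0%N)) ->
  exists2 b, (forall j0, j = j0.+1 -> cochain j0 d b)
    & forall s : {set 'I_4}, #|s| = j -> frac_eq (cech_prod s) (c s) (cech_diff b s).

Definition regular (r : int * int) : Prop :=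
  (forall (j : nat) (lam : nat * nat) (p : int * int),
     (1 <= j)%N -> (lam.1 + lam.2 = j.-1)%N ->
     lez2 (r - (lam.1%:Z, lam.2%:Z)) p -> loc_coh_zero j p) /\
  (forall p, lez2 (r + (1, 0)) p || lez2 (r + (0, 1)) p -> loc_coh_zero 0 p).

Definition minimal_regular (r : int * int) : Prop :=
  regular r /\ forall q, regular q -> lez2 q r -> q = r.

End Cech.

(* Multihomogeneous polynomials in the coordinates of (P^1 x P^1)^n: the
   variable mxvec_index l i is the i-th coordinate, i in 'I_(2 + 2), of the
   l-th point. *)
Definition multihomog (k : closedFieldType) (n : nat)
    (f : {mpoly k[n * (2 + 2)]}) : Prop :=
  exists e : 'I_n -> nat * nat, forall m, m \in msupp f -> forall l : 'I_n,
    (\sum_(j < 2) m (mxvec_index l (lshift 2 j)) = (e l).1)%N /\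
    (\sum_(j < 2) m (mxvec_index l (rshift 2 j)) = (e l).2)%N.

Definition tuple_coords (k : closedFieldType) (n : nat)
    (P : n.-tuple (P1xP1 k)) (A : 'M[k]_(n, 2 + 2)) : Prop :=
  forall l, [/\ lsubmx (row l A) != 0, lsubmx (row l A) \in line (tnth P l).1,
                rsubmx (row l A) != 0 & rsubmx (row l A) \in line (tnth P l).2].

Definition zariski_closed (k : closedFieldType) (n : nat)
    (Z : n.-tuple (P1xP1 k) -> Prop) : Prop :=
  exists T : {mpoly k[n * (2 + 2)]} -> Prop,
    (forall f, T f -> multihomog f) /\
    forall P, Z P <->
      forall f A, T f -> tuple_coords P A -> f.@[mxvec A ord0] = 0.

Definition zariski_open (k : closedFieldType) (n : nat)
    (U : n.-tuple (P1xP1 k) -> Prop) : Prop := zariski_closed (fun P => ~ U P).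

Definition zariski_dense (k : closedFieldType) (n : nat)
    (U : n.-tuple (P1xP1 k) -> Prop) : Prop :=
  forall V, zariski_open V -> (exists P, V P) -> exists P, V P /\ U P.

Definition generic_betti1 (k : closedFieldType) (X : seq (P1xP1 k)) : Prop :=
  forall F : gcomplex k, min_free_res F (coord_ring X) ->
  forall r r' : int,
    let d := hilb_diff2 X in
    let c := d r r' < 0 /\ ((exists s', r' < s' /\ 0 < d r s') \/
                            (exists s, r < s /\ 0 < d s r')) in
    (c -> (betti F 1 (r, r'))%:Z = - d r r') /\ (~ c -> betti F 1 (r, r') = 0%N).

(* U is a set as in the theorem of Giuffrida, Maggioni and Ragusa; the points
   P_1, ..., P_n are in sufficiently general position when (P_1, ..., P_n)
   lies in U. *)
Definition general_position_locus (k : closedFieldType) (n : nat)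
    (U : n.-tuple (P1xP1 k) -> Prop) : Prop :=
  [/\ zariski_open U, zariski_dense U
    & forall P, U P -> generic_hilb P /\ generic_betti1 P].

(* Main.v *)
Require Import Defs.
From HB Require Import structures.
From mathcomp Require Import all_boot all_order all_algebra.
From mathcomp Require Import boolp mpoly ring zify.

(** Let (i, i') be the given minimal regular degree.  The bidegree (i + 1, i' + 1)
    is the upper corner of the region that cuts the virtual resolution out of the
    minimal free resolution F.  So it suffices to find a generator of F_3 in this
    bidegree, and to show that F_p = 0 for p >= 4.

    The generator is found by an Euler characteristic.  The dimensions of the
    degree r parts of the F_p, with alternating signs, add up to the Hilbert
    function of S / I_X at r, and the second difference of the Hilbert function of
    S(-a, -a') is 1 at (a, a') and 0 elsewhere; therefore d_r is the alternating sum
    of the Betti numbers beta_(p, r) ([hilb_diff2_betti]).  At the corner the generic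
    Hilbert function gives d = 3n - 3ii' - 2i - 2i', which is negative by hypothesis
    ([hilb_diff2_corner]).  Further along the row and the column of the corner no
    entry of the second difference is positive ([hilb_diff2_row],
    [hilb_diff2_column]), and for points in general position this forces
    beta_1 = 0 at the corner.  The negative sign then has to come from beta_3.

    These values of d use i >= 1, i (i' + 1) < n and (i + 1) i' < n, which come from
    minimality ([minimal_regular_bounds]).  In each degree S / I_X and its
    localizations consist of functions on X, and the Cech complex becomes a family of
    cochain complexes of simplices, one for each point.  Hence the local cohomology
    vanishes where every function on X is the restriction of a form, and a degree
    (a, b) in N^2 with (a + 1)(b + 1) >= n is regular ([regular_independent]).  On the
    other hand H^1_B does not vanish in degree (-1, -1) ([loc_coh1_neg]), which
    excludes that i and i' are both negative.

    The vanishing of F_p for p >= 4 ([gen_empty]) is the Auslander-Buchsbaum formula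
    for S / I_X, which has positive depth: some linear form l in x_0, x_1 vanishes at
    no point of X, so it is a nonzerodivisor on S / I_X.  Exactness of F passes to F / lF
    without loss, then to the quotients by x_1, y_0 and y_1 with a loss of one degree
    each; since a minimal complex has zero differential modulo all the variables, its
    exactness there from F_4 on leaves no generators. *)

Set Implicit Arguments.
Unset Strict Implicit.
Unset Printing Implicit Defensive.
Import Order.TTheory GRing.Theory Num.Theory.
Local Open Scope ring_scope.

(** * Evaluation on the points of X *)

Lemma bihomog_meval_scale (k : closedFieldType) (d : int * int) (f : cox k)
    (a b : k) (u v : 'rV[k]_2) : bihomog d f ->
  f.@[row_mx (a *: u) (b *: v) ord0] =
    a ^+ `|d.1| * b ^+ `|d.2| * f.@[row_mx u v ord0].
Proof.
move=> hf; rewrite !mevalE mulr_sumr; apply: eq_big_seq => m mf.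
have /eqP <- : bideg m == d by apply: (allP hf).
rewrite mulrCA; congr (_ * _); rewrite !big_split_ord /= -!prodrXr.
rewrite [RHS]mulrACA; congr (_ * _); rewrite -big_split; apply: eq_bigr => j _ /=.
  by rewrite !row_mxEl mxE exprMn.
by rewrite !row_mxEr mxE exprMn.
Qed.

(** One choice of homogeneous coordinates for the point, at which forms are
    evaluated. *)
Definition coords (k : closedFieldType) (p : P1xP1 k) : 'I_(2 + 2) -> k :=
  row_mx (vpick (line p.1)) (vpick (line p.2)) ord0.

Lemma line_pick (k : closedFieldType) (L : P1 k) :
  vpick (line L) != 0 /\ line L = <[vpick (line L)]>%VS.
Proof.
case: L => L /= dL.
have L0 : vpick L != 0 by rewrite vpick0 -dimv_eq0 (eqP dL).
split=> //; apply/eqP; rewrite eq_sym eqEdim -memvE memv_pick dim_vline L0.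
by rewrite (eqP dL).
Qed.

(** Rescaling the coordinates multiplies a bihomogeneous form by nonzero scalars,
    so one representative of the point decides. *)
Lemma vanishes_at_coords (k : closedFieldType) (d : int * int) (f : cox k)
    (p : P1xP1 k) : bihomog d f -> vanishes_at f p <-> f.@[coords p] = 0.
Proof.
move=> hf; have [u0 hu] := line_pick p.1; have [v0 hv] := line_pick p.2; split.
  by move=> h; apply: h; rewrite ?memv_pick.
move=> f0 u v _ _; rewrite hu hv => /vlineP[a ->] /vlineP[b ->].
by rewrite (bihomog_meval_scale _ _ _ _ hf) -/(coords p) f0 mulr0.
Qed.

Section Evaluation.
Variables (k : closedFieldType) (X : seq (P1xP1 k)).
Local Open Scope quotient_scope.
Local Notation M := (coord_ring X).
Local Notation Q := {ideal_quot IX X}.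
Implicit Types (f g : cox k) (d : int * int) (p : P1xP1 k) (u v : M).

Lemma IX_vanish f p : f \in IX X -> p \in X -> f.@[coords p] = 0.
Proof.
move=> /asboolP[r [a [h [hV ->]]]] pX; rewrite raddf_sum big1 //= => l _.
have [[d hd] /(_ p pX)/(vanishes_at_coords p hd) h0] := hV l.
by rewrite mevalM h0 mulr0.
Qed.

Lemma bihomog_IX d f : bihomog d f ->
  (forall p, p \in X -> f.@[coords p] = 0) -> f \in IX X.
Proof.
move=> hf f0; apply/asboolP; exists 1%N, (fun=> 1), (fun=> f); split=> [_|].
  by split=> [|p pX]; [exists d | apply/(vanishes_at_coords p hf)/f0].
by rewrite big_ord1 mul1r.
Qed.

(** Evaluation at a point descends to S / I_X when the point lies in X; the value
    outside X depends on the representative of the class and has no meaning. *)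
Definition evm p (u : M) : k := (repr (u : Q)).@[coords p].

Lemma evm_pi p f : p \in X -> evm p (\pi_Q f : Q) = f.@[coords p].
Proof.
move=> pX; apply/eqP; rewrite -subr_eq0 -mevalB; apply/eqP.
by apply: IX_vanish pX; apply/piQ_eq; rewrite reprK.
Qed.

Lemma pi_surj u : exists f, u = (\pi_Q f : Q).
Proof. by exists (repr (u : Q)); rewrite reprK. Qed.

Lemma evmD p u v : p \in X -> evm p (u + v) = evm p u + evm p v.
Proof.
move=> pX; have [f ->] := pi_surj u; have [g ->] := pi_surj v.
have -> : (\pi_Q f : M) + (\pi_Q g : Q) = (\pi_Q (f + g) : Q) by rewrite raddfD.
by rewrite !evm_pi // mevalD.
Qed.

Lemma evmZ p f u : p \in X -> evm p (f *: u) = f.@[coords p] * evm p u.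
Proof.
move=> pX; have [g ->] := pi_surj u.
have -> : f *: (\pi_Q g : M) = (\pi_Q (f * g) : Q) by exact: quot_scale_pi.
by rewrite !evm_pi // mevalM.
Qed.

Lemma evm0 p : p \in X -> evm p 0 = 0.
Proof. by move=> pX; have := evmZ 0 0 pX; rewrite scaler0 meval0 mul0r. Qed.

Lemma evm_sum p (I : Type) (r : seq I) (P : pred I) (F : I -> M) : p \in X ->
  evm p (\sum_(i <- r | P i) F i) = \sum_(i <- r | P i) evm p (F i).
Proof.
move=> pX; apply: (big_morph (evm p)) => [u v|]; [exact: evmD | exact: evm0].
Qed.

(** A form that vanishes on X is in I_X by definition: S / I_X embeds, degree by
    degree, in the functions on X. *)
Lemma evm_inj d u : gm_part d u -> (forall p, p \in X -> evm p u = 0) -> u = 0.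
Proof.
move=> [f hf ->] h; apply/piQ_eq0; apply: (bihomog_IX hf) => p pX.
by rewrite -evm_pi // h.
Qed.

(** A form without zeros on X is a nonzerodivisor on S / I_X: split the element
    into its bihomogeneous components and evaluate each on X. *)
Lemma form_regular d f u : bihomog d f -> (forall p, p \in X -> f.@[coords p] != 0) ->
  f *: u = 0 -> u = 0.
Proof.
move=> hf f0; have [g ->] := pi_surj u.
have -> : f *: (\pi_Q g : M) = (\pi_Q (f * g) : Q) by exact: quot_scale_pi.
move=> /piQ_eq0 fg; apply/piQ_eq0; rewrite (hcomp_sum g).
apply: rpred_sum => e _; apply: (bihomog_IX (bihomog_hcomp e g)) => p pX.
have := IX_hcomp (e + d) fg; rewrite mulrC (hcompM _ _ hf) addrK.
by move=> /IX_vanish/(_ pX)/eqP; rewrite mevalM mulf_eq0 (negPf (f0 p pX)) orbF => /eqP.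
Qed.

End Evaluation.

Lemma part_dimP (k : closedFieldType) (M : gmodule k) d :
  (0 < part_dim M d)%N -> part_has_dim M d (part_dim M d).
Proof. by rewrite /part_dim; case: pselect => // h _; case: cid. Qed.

Lemma gm_partN (k : closedFieldType) (M : gmodule k) d (u : M) :
  gm_part d u -> gm_part d (- u).
Proof. by move=> hu; rewrite -sub0r; apply: gm_partB => //; apply: gm_part0. Qed.

Lemma gm_partD (k : closedFieldType) (M : gmodule k) d (u v : M) :
  gm_part d u -> gm_part d v -> gm_part d (u + v).
Proof. by move=> hu hv; rewrite -[v]opprK; apply: gm_partB => //; apply: gm_partN. Qed.

Lemma gm_part_sum (k : closedFieldType) (M : gmodule k) d (I : Type) (r : seq I)
    (P : pred I) (F : I -> M) :
  (forall i, P i -> gm_part d (F i)) -> gm_part d (\sum_(i <- r | P i) F i).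
Proof.
move=> h; elim/big_rec: _ => [|i u Pi]; first exact: gm_part0.
by apply: gm_partD; apply: h.
Qed.

Lemma bihomogC (k : closedFieldType) (c : k) : bihomog 0 (c%:MP : cox k).
Proof.
apply/bihomogP => m; rewrite mcoeffC; have [->|_] := eqVneq m 0%MM; last by rewrite mulr0 eqxx.
by move=> _; congr (Posz _, Posz _); rewrite big1 // => j _; rewrite mnmE.
Qed.

Lemma bihomog_neg (k : closedFieldType) (d : int * int) (f : cox k) :
  bihomog d f -> (d.1 < 0) || (d.2 < 0) -> f = 0.
Proof.
move=> /bihomogP hf dn; apply/mpolyP => m; rewrite mcoeff0; apply/eqP.
by apply: contraLR dn => /hf <-; rewrite /bideg /=; lia.
Qed.

Lemma bihomogZ (k : closedFieldType) d (c : k) (f : cox k) :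
  bihomog d f -> bihomog d (c%:MP * f).
Proof. by move=> hf; rewrite -[d]add0r; apply: bihomogM => //; apply: bihomogC. Qed.

Lemma bihomogXn (k : closedFieldType) d (f : cox k) t :
  bihomog d f -> bihomog (d *+ t) (f ^+ t).
Proof.
move=> hf; elim: t => [|t IH]; first by rewrite mulr0n expr0 -mpolyC1; apply: bihomogC.
by rewrite mulrS exprS; apply: bihomogM.
Qed.

(** Evaluation embeds the n-dimensional space (S / I_X)_d in the n-dimensional
    space of functions on X, so it is onto: X imposes independent conditions on the
    forms of bidegree d. *)
Lemma evm_surj (k : closedFieldType) (X : seq (P1xP1 k)) (d : int * int)
    (w : P1xP1 k -> k) : uniq X -> part_has_dim (coord_ring X) d (size X) ->
  exists2 u : coord_ring X, gm_part d u & forall p, p \in X -> evm p u = w p.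
Proof.
move=> uX [e [he hfree _]].
pose A : 'M[k]_(size X) := \matrix_(i, j) evm (tnth (in_tuple X) j) (e i).
have evA (c : 'rV[k]_(size X)) (j : 'I_(size X)) :
    evm (tnth (in_tuple X) j) (\sum_i (c 0 i)%:MP *: e i : coord_ring X) = (c *m A) 0 j.
  rewrite evm_sum ?mem_tnth // mxE; apply: eq_bigr => i _.
  by rewrite evmZ ?mem_tnth // mevalC mxE.
have hpart (c : 'rV[k]_(size X)) : gm_part d (\sum_i (c 0 i)%:MP *: e i : coord_ring X).
  apply: gm_part_sum => i _; rewrite -[d]add0r.
  by apply: gm_partZ; [exact: bihomogC | exact: he].
have Aunit : row_free A.
  rewrite -kermx_eq0; apply/eqP/row_matrixP => i.
  set c := row i _; rewrite row0.
  have cA : c *m A = 0 by rewrite /c -row_mul mulmx_ker row0.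
  apply/rowP => j; rewrite [RHS]mxE; apply: (hfree (fun j => c 0 j)).
  apply: (evm_inj (hpart c)) => p /(tnthP (in_tuple X)) [l ->].
  by rewrite evA cA mxE.
pose c := (\row_j w (tnth (in_tuple X) j)) *m invmx A.
exists (\sum_i (c 0 i)%:MP *: e i : coord_ring X) => // p /(tnthP (in_tuple X)) [l ->].
by rewrite evA /c mulmxKV ?mxE // -row_free_unit.
Qed.

Lemma part_has_dim_generic (k : closedFieldType) (X : seq (P1xP1 k)) (a b : nat) :
  uniq X -> generic_hilb X -> (size X <= a.+1 * b.+1)%N -> (0 < size X)%N ->
  part_has_dim (coord_ring X) (a%:Z, b%:Z) (size X).
Proof.
move=> uX gX le_n n0; have := gX a b; rewrite /hilb /= undup_id //.
rewrite (minn_idPl le_n) => -[e]; have := @part_dimP _ (coord_ring X) (a%:Z, b%:Z).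
by rewrite e; apply.
Qed.

(** * Local cohomology and regularity *)

Lemma bihomogX (k : closedFieldType) (i : 'I_(2 + 2)) :
  bihomog (if (i < 2)%N then (1, 0) else (0, 1)) ('X_i : cox k).
Proof.
apply/bihomogP => m; rewrite mcoeffX; have [<- _|_] := eqVneq U_(i)%MM m; last by rewrite eqxx.
by rewrite /bideg !big_ord_recl !big_ord0 !mnmE; case: i => [[|[|[|[|]]]]].
Qed.

Lemma cech_gen_homog (k : closedFieldType) l : bihomog (1, 1) (cech_gen k l).
Proof.
have -> : (1, 1) = (1, 0) + (0, 1) :> (int * int)%type by [].
rewrite /cech_gen (tnth_nth 0).
by case: l => [[|[|[|[|]]]]] //= _; apply: bihomogM; apply: bihomogX.
Qed.

Lemma cech_prod_homog (k : closedFieldType) (s : {set 'I_4}) :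
  bihomog (#|s|%:Z, #|s|%:Z) (cech_prod k s).
Proof.
have -> : (#|s|%:Z, #|s|%:Z) = \sum_(l in s) (1, 1) :> (int * int)%type.
  by rewrite sumr_const; elim: #|s| => // t IH; rewrite mulrS -IH.
rewrite /cech_prod; elim/big_rec2: _ => [|l d f _ hf].
  by rewrite -mpolyC1; apply: bihomogC.
by apply: bihomogM => //; apply: cech_gen_homog.
Qed.

(** The ideal B has no zero on P^1 x P^1. *)
Lemma cech_gen_neq0 (k : closedFieldType) (p : P1xP1 k) :
  exists l, (cech_gen k l).@[coords p] != 0.
Proof.
have [u0 _] := line_pick p.1; have [v0 _] := line_pick p.2.
have coordl j : coords p (lshift 2 j) = vpick (line p.1) 0 j by rewrite /coords row_mxEl.
have coordr j : coords p (rshift 2 j) = vpick (line p.2) 0 j by rewrite /coords row_mxEr.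
have [i ui] : exists i, coords p (lshift 2 i) != 0.
  have /rV0Pn[j] := u0; by exists j; rewrite coordl.
have [j vj] : exists j, coords p (rshift 2 j) != 0.
  have /rV0Pn[j] := v0; by exists j; rewrite coordr.
exists (inord (i * 2 + j)); suff -> : cech_gen k (inord (i * 2 + j)) =
    'X_(lshift 2 i) * 'X_(rshift 2 j).
  by rewrite mevalM !mevalXU mulf_neq0.
rewrite /cech_gen (tnth_nth 0) inordK; last by move: (ltn_ord i) (ltn_ord j); lia.
case: i {ui} => [[|[|]]] //= hi; case: j {vj} => [[|[|]]] //= hj;
  by congr ('X_(lshift 2 _) * 'X_(rshift 2 _)); apply: val_inj.
Qed.

(** The sign with which [s :\ l] enters the Cech differential at [s]. *)
Definition cech_sign (k : closedFieldType) (l : 'I_4) (s : {set 'I_4}) : k :=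
  (-1) ^+ #|[set l' in s | (l' < l)%N]|.

Lemma card_setU1_sub (T : finType) (P : pred T) (x : T) (A : {set T}) :
  x \notin A -> #|[set y in x |: A | P y]| = (P x + #|[set y in A | P y]|)%N.
Proof.
move=> xA; rewrite -!sum1dep_card big_mkcondr big_setU1 //= -big_mkcondr.
by case: (P x).
Qed.

Lemma cech_signU1 (k : closedFieldType) l l0 (s : {set 'I_4}) : l0 \notin s ->
  cech_sign k l (l0 |: s) = (-1) ^+ (l0 < l)%N * cech_sign k l s.
Proof. by move=> ls; rewrite /cech_sign card_setU1_sub // exprD. Qed.

Lemma cech_sign_sq (k : closedFieldType) l s : cech_sign k l s * cech_sign k l s = 1.
Proof. by rewrite -expr2 sqrr_sign. Qed.

(** The sign rule behind the contracting homotopy: a sign counts the smaller elements,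
    so of l and l0 only the larger one changes sign when the other is removed. *)
Lemma cech_sign_swap (k : closedFieldType) l l0 (s : {set 'I_4}) :
  l0 \notin s -> l \in s ->
  cech_sign k l s * cech_sign k l0 (l0 |: s :\ l) =
    - (cech_sign k l0 (l0 |: s) * cech_sign k l (l0 |: s)).
Proof.
move=> ls0 ls; have l0l : l0 != l by apply: contraNneq ls0 => ->.
have e : l0 |: s = l |: (l0 |: s :\ l) by rewrite setUCA setD1K.
have ll : l \notin l0 |: s :\ l by rewrite !inE eqxx eq_sym (negPf l0l).
rewrite (cech_signU1 _ l ls0) e (cech_signU1 _ l0 ll).
have := l0l; rewrite -(inj_eq val_inj) /= => /negPf ll0.
case: (ltngtP l l0) => h; rewrite ?expr1 ?expr0 ?mulN1r ?mul1r ?mulrN ?mulNr ?opprK.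
- by rewrite mulrC.
- by rewrite mulrC.
- by rewrite h eqxx in ll0.
Qed.

Section Cech.
Variables (k : closedFieldType) (X : seq (P1xP1 k)).
Hypotheses (uX : uniq X) (gX : generic_hilb X) (X0 : (0 < size X)%N).
Local Notation M := (coord_ring X).
Local Notation fv p s := ((cech_prod k s).@[coords p]).
Implicit Types (s : {set 'I_4}) (d : int * int) (p : P1xP1 k) (u v : M * nat).

(** The value at [p] of the fraction [u] with denominator a power of f_s; it is
    meaningful where f_s does not vanish. *)
Definition fracv p s u : k := evm p u.1 / fv p s ^+ u.2.

Lemma fv_D1 p s l : l \in s -> fv p s = (cech_gen k l).@[coords p] * fv p (s :\ l).
Proof. by move=> ls; rewrite /cech_prod (big_setD1 l) //= mevalM. Qed.

Lemma fv_D1_neq0 p s l : fv p s != 0 -> fv p (s :\ l) != 0.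
Proof.
have [ls|ls] := boolP (l \in s).
  by rewrite (fv_D1 _ ls) mulf_eq0 negb_or => /andP[].
suff -> : s :\ l = s by [].
by apply/setDidPl; rewrite disjoint_sym disjoints1.
Qed.

Lemma fv_U1_neq0 p s l : (cech_gen k l).@[coords p] != 0 -> fv p s != 0 ->
  fv p (l |: s) != 0.
Proof.
move=> gl fs; rewrite (fv_D1 _ (setU11 l s)) mulf_neq0 //.
have [ls|ls] := boolP (l \in s); last by rewrite setU1K.
by rewrite (setUidPr _) ?sub1set //; apply: fv_D1_neq0.
Qed.

Lemma frac_homogE s d (m : M) t :
  frac_homog s d (m, t) = gm_part (d + (#|s|%:Z, #|s|%:Z) *+ t) m.
Proof. by []. Qed.

Lemma frac_homog_add s d u v : frac_homog s d u -> frac_homog s d v ->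
  frac_homog s d (frac_add (cech_prod k s) u v).
Proof.
move=> hu hv; rewrite /frac_add frac_homogE mulrnDr; apply: gm_partD.
  rewrite addrA addrC; apply: gm_partZ => //.
  exact/bihomogXn/cech_prod_homog.
rewrite addrCA; apply: gm_partZ => //.
exact/bihomogXn/cech_prod_homog.
Qed.

Lemma frac_homog0 s d : frac_homog s d ((0 : M), 0%N).
Proof. exact: gm_part0. Qed.

Lemma frac_homog_cech_diff j s d (c : {set 'I_4} -> M * nat) :
  cochain j d c -> #|s| = j.+1 -> frac_homog s d (cech_diff c s).
Proof.
move=> hc sj; apply: big_ind => [||l ls]; first exact: frac_homog0.
  by move=> u v; apply: frac_homog_add.
have sl : #|s :\ l| = j by move: sj; rewrite (cardsD1 l s) ls => -[].
rewrite frac_homogE -[X in gm_part X]add0r; apply: gm_partZ.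
  rewrite -[0](mul0rn _ #|[set l' in s | (l' < l)%N]|); apply: bihomogXn.
  by rewrite -mpolyC1 -mpolyCN; apply: bihomogC.
have -> : (#|s|%:Z, #|s|%:Z) = (1, 1) + (#|s :\ l|%:Z, #|s :\ l|%:Z) :> (int * int)%type.
  by rewrite sj sl.
rewrite mulrnDl addrCA; apply: gm_partZ; first exact/bihomogXn/cech_gen_homog.
exact: (hc _ sl).
Qed.

Lemma fracv_cech_diff p s (c : {set 'I_4} -> M * nat) : p \in X -> fv p s != 0 ->
  fracv p s (cech_diff c s) =
    \sum_(l in s) cech_sign k l s * fracv p (s :\ l) (c (s :\ l)).
Proof.
move=> pX fs; rewrite /cech_diff (big_morph (fracv p s) (id1 := 0) (op1 := +%R)).
- apply: eq_bigr => l ls; rewrite /fracv /= !evmZ // rmorph_sign rmorphXn /=.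
  rewrite -/(cech_sign k l s) -mulrA; congr (_ * _).
  move: fs; rewrite (fv_D1 _ ls) mulf_eq0 negb_or => /andP[gl fl].
  by rewrite exprMn -mulf_div divff ?mul1r // expf_neq0.
- move=> u v; rewrite /fracv /= evmD // !evmZ // !rmorphXn /= exprD.
  by field; rewrite !expf_neq0.
- by rewrite /fracv /= evm0 // mul0r.
Qed.

(** The localization of S / I_X at f_s is, degree by degree, contained in the
    functions on the part of X where f_s is nonzero; multiplying by f_s once kills
    whatever happens at the other points. *)
Lemma frac_eqP s d u v : frac_homog s d u -> frac_homog s d v ->
  frac_eq (cech_prod k s) u v <->
  (forall p, p \in X -> fv p s != 0 -> fracv p s u = fracv p s v).
Proof.
move=> hu hv; split=> [[t e] p pX fs|h].
  move: (congr1 (evm p) e); rewrite evm0 // evmZ // rmorphXn /=.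
  move/eqP; rewrite mulf_eq0 (negPf (expf_neq0 _ fs)) /=.
  rewrite -scaleN1r evmD // !evmZ // !rmorphXn rmorphN1 /= => /eqP e'.
  apply/eqP; rewrite /fracv eqr_div ?expf_neq0 //; apply/eqP.
  by rewrite mulrC; apply/eqP; rewrite -subr_eq0 -e' mulN1r [_ * evm p v.1]mulrC.
exists 1%N; rewrite expr1.
have hp : gm_part (d + (#|s|%:Z, #|s|%:Z) *+ (u.2 + v.2))
    (cech_prod k s ^+ v.2 *: u.1 - cech_prod k s ^+ u.2 *: v.1).
  rewrite mulrnDr; apply: gm_partB.
    by rewrite addrA addrC; apply: gm_partZ => //; apply/bihomogXn/cech_prod_homog.
  by rewrite addrCA; apply: gm_partZ => //; apply/bihomogXn/cech_prod_homog.
apply: (evm_inj (gm_partZ (cech_prod_homog k s) hp)) => p pX.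
rewrite evmZ //; have [->|fs] := eqVneq (fv p s) 0; first by rewrite mul0r.
have /eqP := h p pX fs; rewrite /fracv eqr_div ?expf_neq0 // => /eqP e.
rewrite -scaleN1r evmD // !evmZ // !rmorphXn rmorphN1 /=.
by rewrite mulN1r mulrC [_ * evm p v.1]mulrC -e [_ * evm p u.1]mulrC subrr mul0r.
Qed.

(** For a generic Hilbert function, these are the bidegrees in N^2 where X imposes
    independent conditions on forms. *)
Definition independent_deg d := [&& 0 <= d.1, 0 <= d.2 & (size X)%:Z <= (d.1 + 1) * (d.2 + 1)].

Lemma independent_part d : independent_deg d -> part_has_dim M d (size X).
Proof.
case: d => [[a|a] [b|b]] // /and3P[_ _ /=] ab.
by apply: part_has_dim_generic => //; rewrite -lez_nat PoszM -[a.+1]addn1 -[b.+1]addn1 !PoszD.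
Qed.

(** After multiplication by a high power of f_s every bidegree becomes one where X
    imposes independent conditions, as f_s has positive degree in both gradings as
    soon as s is nonempty. *)
Lemma frac_lift s d (w : P1xP1 k -> k) : (0 < #|s|)%N || independent_deg d ->
  exists2 u, frac_homog s d u
    & forall p, p \in X -> fv p s != 0 -> fracv p s u = w p.
Proof.
move=> h; have [t ht] : exists t, independent_deg (d + (#|s|%:Z, #|s|%:Z) *+ t).
  have pairMn (z : int) t : (z, z) *+ t = (z *+ t, z *+ t) :> (int * int)%type.
    by elim: t => // t IH; rewrite !mulrS IH.
  have [s0|s0] := posnP #|s|.
    by exists 0%N; rewrite mulr0n addr0; move: h; rewrite s0.
  (* This exponent makes both coordinates of the new bidegree at least the number of
     points. *)
  exists (size X + `|d.1| + `|d.2|)%N; rewrite pairMn -mulr_natr natz.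
  set t := (_ + _ + _)%N.
  have st : t%:Z <= #|s|%:Z * t%:Z by move: s0; nia.
  case: d {h} @t st => a b /= st.
  move: s0 X0 st; rewrite /independent_deg /=; move: #|s| (size X) => c n s0 n0 st.
  have ha : n%:Z <= a + c%:Z * (n + `|a| + `|b|)%N%:Z by lia.
  have hb : n%:Z <= b + c%:Z * (n + `|a| + `|b|)%N%:Z by lia.
  move: ha hb; move: (a + _) (b + _) => A B ha hb; apply/and3P; split; [lia|lia|nia].
have [u hu ew] := evm_surj (fun p => w p * fv p s ^+ t) uX (independent_part ht).
exists (u, t) => // p pX fs; rewrite /fracv ew //= mulfK //.
by rewrite expf_neq0.
Qed.

(** H^0_B vanishes because I_X is saturated: near each point of X some generator of
    B is invertible. *)
Lemma loc_coh0 d : loc_coh_zero M 0 d.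
Proof.
move=> c hc cocyc; exists c => // s s0.
have hd : frac_homog s d (cech_diff c s).
  by rewrite /cech_diff (cards0_eq s0) big_set0; apply: frac_homog0.
apply/(frac_eqP (hc s s0) hd) => p pX fs.
rewrite (cards0_eq s0) in fs *; rewrite /cech_diff big_set0.
have [l gl] := cech_gen_neq0 p.
have fl : fv p [set l] != 0 by rewrite -(setU0 [set l]); apply: fv_U1_neq0.
have hl := frac_homog_cech_diff hc (cards1 l).
have /(frac_eqP hl (frac_homog0 _ _))/(_ p pX fl) := cocyc _ (cards1 l).
rewrite fracv_cech_diff // big_set1 setDv.
rewrite /fracv /= !evm0 // !mul0r => /eqP.
by rewrite mulf_eq0 signr_eq0 => /eqP.
Qed.

(** Pointwise, the Cech complex at p in X is the augmented cochain complex of the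
    simplex on the generators of B that do not vanish at p.  The simplex has a
    vertex [l0 p], and inserting this vertex is a contracting homotopy.  [frac_lift]
    glues these homotopies to a cochain with values in the localizations of S / I_X;
    the assumption on j and d says that this is possible in cohomological degree
    j - 1, where s is empty for j = 1. *)
Lemma loc_coh_vanish j d : (1 < j)%N || (0 < j)%N && independent_deg d -> loc_coh_zero M j d.
Proof.
case: j => // j hj c hc cocyc.
pose V p s := fracv p s (c s).
have /choice[l0 gl0] := @cech_gen_neq0 k.
(* The values of the homotopy: insert the vertex l0 p into s. *)
pose w s p := if l0 p \in s then 0 else cech_sign k (l0 p) (l0 p |: s) * V p (l0 p |: s).
have /choice[b hb] : forall s, exists u, #|s| = j -> frac_homog s d u /\
    forall p, p \in X -> fv p s != 0 -> fracv p s u = w s p.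
  move=> s; have [sj|sj] := eqVneq #|s| j; last by exists (0, 0%N) => /eqP; rewrite (negPf sj).
  have [|u hu eu] := @frac_lift s d (w s); last by exists u.
  by rewrite sj -ltnS; move: hj; case: (1 < j.+1)%N.
have bc : cochain j d b by move=> s /hb[].
exists b => [j0 [<-] //|s sj].
apply/(frac_eqP (hc s sj) (frac_homog_cech_diff bc sj)) => p pX fs.
rewrite fracv_cech_diff // -/(V p s).
rewrite (eq_bigr (fun l => cech_sign k l s * w (s :\ l) p)) => [|l ls]; last first.
  have [|_ ->] // := hb (s :\ l); last exact: fv_D1_neq0.
  by move: sj; rewrite (cardsD1 l s) ls => -[].
have [ls|ls] := boolP (l0 p \in s).
  rewrite (bigD1 (l0 p)) //= big1 => [|l /andP[_ ll]]; last first.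
    by rewrite /w !inE ls eq_sym ll mulr0.
  by rewrite addr0 /w !inE eqxx /= setD1K // mulrA cech_sign_sq mul1r.
have fl : fv p (l0 p |: s) != 0 by apply: fv_U1_neq0.
have sl : #|l0 p |: s| = j.+2 by rewrite cardsU1 ls sj.
have := cocyc _ sl.
move=> /(frac_eqP (frac_homog_cech_diff hc sl) (frac_homog0 _ _))/(_ p pX fl).
rewrite fracv_cech_diff // big_setU1 //= setU1K // -/(V p s).
rewrite {2}/fracv /= evm0 // mul0r => /eqP; rewrite addr_eq0 => /eqP e.
rewrite -[V p s]mul1r -(cech_sign_sq k (l0 p) (l0 p |: s)) -mulrA e mulrN mulr_sumr -sumrN.
apply: eq_bigr => l lls; have ll : l != l0 p by apply: contraNneq ls => <-.
rewrite /w !inE (negPf ls) andbF mulrA cech_sign_swap // mulNr -mulrA.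
rewrite -/(V p _); congr (- (_ * (_ * V p _))).
by apply/setP => x; rewrite !inE; case: eqVneq => // ->; rewrite (negPf ll).
Qed.

Lemma regular_independent d : independent_deg d -> regular M d.
Proof.
move=> hd; split=> [j lam p j1 jl|p _]; last exact: loc_coh0.
rewrite /lez2 /= => dp; apply: loc_coh_vanish.
have [e|j1'] := eqVneq j 1%N; last by rewrite ltn_neqAle eq_sym j1' j1.
rewrite e in jl *; have [l1 l2] : lam.1 = 0%N /\ lam.2 = 0%N by lia.
move: hd dp; rewrite l1 l2 !subr0 /independent_deg /= => /and3P[? ? ?] /andP[? ?].
by apply/and3P; split; [lia|lia|nia].
Qed.

(** The constant function 1 on X, viewed in degree (-1, -1), is a Cech cocycle; it
    does not come from (S / I_X)_(-1, -1), which is 0. *)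
Lemma loc_coh1_neg : ~ loc_coh_zero M 1 (-1, -1).
Proof.
have /choice[c hc] : forall s, exists u, (0 < #|s|)%N -> frac_homog s (-1, -1) u /\
    forall p, p \in X -> fv p s != 0 -> fracv p s u = 1.
  move=> s; have [s0|s0] := posnP #|s|; first by exists (0, 0%N).
  by have [|u hu eu] := @frac_lift s (-1, -1) (fun=> 1); [rewrite s0 | exists u].
have cc : cochain 1 (-1, -1) c by move=> s s1; apply: (hc s _).1; rewrite s1.
move=> /(_ c cc)[s s2|b hb eb].
  apply/(frac_eqP (frac_homog_cech_diff cc s2) (frac_homog0 _ _)) => p pX fs.
  rewrite fracv_cech_diff // {2}/fracv /= evm0 // mul0r.
  rewrite (eq_bigr (fun l => cech_sign k l s)) => [|l ls]; last first.
    have sl : #|s :\ l| = 1%N by move: s2; rewrite (cardsD1 l s) ls => -[].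
    by have [|_ ->] // := hc (s :\ l); rewrite ?sl ?mulr1 ?fv_D1_neq0.
  have /cards2P[x [y [xy es]]] : #|s| == 2%N by rewrite s2.
  rewrite es big_setU1 ?inE //= big_set1 -(setU0 [set y]).
  have cs0 l : cech_sign k l set0 = 1.
    by rewrite /cech_sign [X in _ ^+ X](_ : _ = 0%N) // eq_card0 // => z; rewrite !inE.
  rewrite !cech_signU1 ?inE ?orbF // !cs0 !ltnn !mul1r !mulr1.
  have [h|h|/val_inj e] := ltngtP x y; last by rewrite e eqxx in xy.
    by rewrite expr0 expr1 addrN.
  by rewrite expr0 expr1 addNr.
have [p pX] : exists p, p \in X by case: (X) X0 => // p X' _; exists p; rewrite inE eqxx.
have [l gl] := cech_gen_neq0 p.
have fl : fv p [set l] != 0.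
  by rewrite -(setU0 [set l]) fv_U1_neq0 // /cech_prod big_set0 meval1 oner_neq0.
have hb0 : cochain 0 (-1, -1) b by apply: hb.
have /(frac_eqP (cc _ (cards1 l)) (frac_homog_cech_diff hb0 (cards1 l))) := eb _ (cards1 l).
move=> /(_ p pX fl); have [|_ ->] // := hc [set l]; first by rewrite cards1.
rewrite fracv_cech_diff // big_set1 setDv /fracv.
have -> : (b set0).1 = 0.
  have := hb0 set0 (cards0 _); rewrite /frac_homog cards0 mul0rn addr0 => -[f hf ->].
  by rewrite (bihomog_neg hf) // raddf0.
by rewrite evm0 // mul0r mulr0 => /eqP; rewrite oner_eq0.
Qed.

End Cech.

(** A regular pair of negative integers is impossible since regularity at j = 1 would
    reach H^1_B in degree (-1, -1).  The two upper bounds hold because otherwise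
    [regular_independent] would make (i - 1, i') or (i, i' - 1) regular. *)
Lemma minimal_regular_bounds (k : closedFieldType) (X : seq (P1xP1 k)) (i i' : int) :
  uniq X -> generic_hilb X -> (2 <= size X)%N ->
  minimal_regular (coord_ring X) (i, i') -> i <= i' ->
  (size X)%:Z < i * (i' + 2) ->
  [/\ 1 <= i, i * (i' + 1) < (size X)%:Z & (i + 1) * i' < (size X)%:Z].
Proof.
move=> uX gX n2 [reg min] ii h1; have n0 : (0 < size X)%N by apply: leq_trans n2.
have i1 : 1 <= i.
  case: (ltP i 1) => // i_lt; have {}i_lt : i <= 0 by lia.
  have i'_lt : i' + 2 < 0 by nia.
  case: (loc_coh1_neg uX gX n0); apply: (reg.1 1%N (0, 0)%N) => //.
  by rewrite /lez2 /=; lia.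
split=> //; rewrite ltNge; apply/negP => h.
  have /min : regular (coord_ring X) (i - 1, i').
    by apply: regular_independent => //; apply/and3P; split=> /=; [lia|lia|rewrite subrK].
  rewrite /lez2 /= => e; have [] : (i - 1, i') = (i, i') by apply: e; lia.
  by lia.
have /min : regular (coord_ring X) (i, i' - 1).
  by apply: regular_independent => //; apply/and3P; split=> /=; [lia|lia|rewrite subrK].
rewrite /lez2 /= => e; have [] : (i, i' - 1) = (i, i') by apply: e; lia.
by lia.
Qed.

(** * The length of the minimal free resolution *)

Lemma ord2P (j : 'I_2) : j = 0 \/ j = 1.
Proof. by case: j => [[|[|]]] // hj; [left | right]; apply: val_inj. Qed.

Record is_ideal (k : closedFieldType) (J : cox k -> Prop) : Prop := IsIdeal {
  ideal0 : J 0;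
  idealB : forall f g, J f -> J g -> J (f - g);
  idealM : forall f g, J g -> J (f * g)
}.

Lemma idealN (k : closedFieldType) (J : cox k -> Prop) f : is_ideal J -> J f -> J (- f).
Proof. by move=> hJ Jf; rewrite -sub0r; apply: idealB => //; apply: ideal0. Qed.

Lemma idealD (k : closedFieldType) (J : cox k -> Prop) f g :
  is_ideal J -> J f -> J g -> J (f + g).
Proof. by move=> hJ Jf Jg; rewrite -[g]opprK; apply: idealB => //; apply: idealN. Qed.

Lemma ideal_sum (k : closedFieldType) (J : cox k -> Prop) (I : Type) (r : seq I)
    (P : pred I) (f : I -> cox k) :
  is_ideal J -> (forall i, P i -> J (f i)) -> J (\sum_(i <- r | P i) f i).
Proof.
move=> hJ h; elim/big_rec: _ => [|i g Pi]; first exact: ideal0.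
by apply: idealD => //; apply: h.
Qed.

Definition adjoin (k : closedFieldType) (J : cox k -> Prop) (l : cox k) : cox k -> Prop :=
  fun f => exists g h, J h /\ f = h + l * g.

Lemma adjoin_ideal (k : closedFieldType) (J : cox k -> Prop) l :
  is_ideal J -> is_ideal (adjoin J l).
Proof.
move=> hJ; split=> [|_ _ [g [h [Jh ->]]] [g' [h' [Jh' ->]]]|f _ [g [h [Jh ->]]]].
- by exists 0, 0; rewrite mulr0 addr0; split=> //; apply: ideal0.
- by exists (g - g'), (h - h'); split; [apply: idealB | ring].
- by exists (f * g), (f * h); split; [apply: idealM | ring].
Qed.

Lemma adjoin_sub (k : closedFieldType) (J : cox k -> Prop) l f : J f -> adjoin J l f.
Proof. by move=> Jf; exists 0, f; rewrite mulr0 addr0. Qed.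

Lemma adjoin_gen (k : closedFieldType) (J : cox k -> Prop) l : is_ideal J -> adjoin J l l.
Proof. by move=> hJ; exists 1, 0; rewrite mulr1 add0r; split=> //; apply: ideal0. Qed.

(** In the uses below an ideal J generated by linear forms is the kernel of the
    substitution that solves these forms for some of the variables; this is how a
    linear form is seen to be regular modulo J. *)
Section Substitution.
Variable k : closedFieldType.
Implicit Types (A B : 'I_2 -> cox k) (f g : cox k) (J : cox k -> Prop).
Local Notation x j := ('X_(lshift 2 j) : cox k).
Local Notation y j := ('X_(rshift 2 j) : cox k).

Definition subst_tuple A B : (2 + 2).-tuple (cox k) :=
  [tuple match split i with inl j => A j | inr j => B j end | i < 2 + 2].
Definition subst_mpoly A B f : cox k := f \mPo subst_tuple A B.

Lemma subst_mpoly_x A B j : subst_mpoly A B (x j) = A j.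
Proof. by rewrite /subst_mpoly comp_mpolyXU -tnth_nth tnth_mktuple (unsplitK (inl j)). Qed.

Lemma subst_mpoly_y A B j : subst_mpoly A B (y j) = B j.
Proof. by rewrite /subst_mpoly comp_mpolyXU -tnth_nth tnth_mktuple (unsplitK (inr j)). Qed.

Lemma ideal_subst J A B f : is_ideal J -> (forall j, J (x j - A j)) ->
  (forall j, J (y j - B j)) -> J (f - subst_mpoly A B f).
Proof.
move=> hJ hA hB; rewrite /subst_mpoly comp_mpolyEX {1}(mpolyE f) -sumrB.
apply: ideal_sum => // m _; rewrite -scalerBr -mul_mpolyC; apply: idealM => //.
rewrite comp_mpolyX mpolyXE_id.
have mulJ a b a' b' : J (a - b) -> J (a' - b') -> J (a * a' - b * b').
  move=> h h'; have -> : a * a' - b * b' = a * (a' - b') + b' * (a - b) by ring.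
  by apply: idealD => //; apply: idealM.
elim/big_rec2: _ => [|i a b _ hab]; first by rewrite subrr; apply: ideal0.
apply: (mulJ) => //; elim: (m i) => [|t IH]; first by rewrite !expr0 subrr; apply: ideal0.
rewrite !exprS; apply: mulJ => //; rewrite tnth_mktuple.
by case: (split_ordP i) => j ->.
Qed.

(** S / J embeds in S through the substitution, so it is a domain. *)
Lemma regular_mod_subst J A B l f : is_ideal J -> (forall j, J (x j - A j)) ->
  (forall j, J (y j - B j)) -> (forall g, J g -> subst_mpoly A B g = 0) ->
  subst_mpoly A B l != 0 -> J (l * f) -> J f.
Proof.
move=> hJ hA hB hker l0 /hker /eqP.
rewrite /subst_mpoly rmorphM /= mulf_eq0 -/(subst_mpoly A B l) (negPf l0) /= => /eqP f0.
by rewrite -[f]subr0 -f0; apply: ideal_subst.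
Qed.

End Substitution.

Section Syzygies.
Variables (k : closedFieldType) (F : gcomplex k).
Local Notation FF p := {ffun gen F p -> cox k}.
Implicit Types (J : cox k -> Prop) (l : cox k).

Definition fscale p l (v : FF p) : FF p := [ffun a => l * v a].

Lemma gmapD p (v w : FF p.+1) : gmap (v + w) = gmap v + gmap w :> FF p.
Proof.
apply/ffunP => b; rewrite !ffunE -big_split; apply: eq_bigr => a _.
by rewrite !ffunE mulrDl.
Qed.

Lemma gmap_scale p l (v : FF p.+1) : gmap (fscale l v) = fscale l (gmap v) :> FF p.
Proof.
apply/ffunP => b; rewrite !ffunE mulr_sumr; apply: eq_bigr => a _.
by rewrite !ffunE mulrA.
Qed.

Lemma gmapN p (v : FF p.+1) : gmap (- v) = - gmap v :> FF p.
Proof.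
apply/ffunP => b; rewrite !ffunE -sumrN; apply: eq_bigr => a _.
by rewrite !ffunE mulNr.
Qed.

Lemma gmap_comp p (v : FF p.+2) : gmap (gmap v : FF p.+1) = 0 :> FF p.
Proof.
apply/ffunP => c; rewrite !ffunE.
under eq_bigr do rewrite ffunE mulr_suml.
rewrite exchange_big big1 //= => a _.
under eq_bigr do rewrite -mulrA.
by rewrite -mulr_sumr gdiff_comp mulr0.
Qed.

Lemma gmap_ideal p J (v : FF p.+1) b : is_ideal J -> (forall a, J (v a)) ->
  J ((gmap v : FF p) b).
Proof.
move=> hJ hv; rewrite ffunE; apply: ideal_sum => // a _.
by rewrite mulrC; apply: idealM.
Qed.

(** Exactness of F / JF at F_(p+1), stated for representatives in F. *)
Definition exact_mod J p := forall v : FF p.+1, (forall b, J ((gmap v : FF p) b)) ->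
  exists (w : FF p.+2) (u : FF p.+1), (forall a, J (u a)) /\ v = gmap w + u.

(** The long exact sequence of multiplication by l, as a diagram chase: if dv is
    l g modulo J, then dg = 0 modulo J by regularity, so g = dw modulo J, and v - l w
    is a cycle modulo J.  One homological degree is lost. *)
Lemma exact_mod_adjoin J l p : is_ideal J -> (forall f, J (l * f) -> J f) ->
  exact_mod J p -> exact_mod J p.+1 -> exact_mod (adjoin J l) p.+1.
Proof.
move=> hJ lreg ex0 ex1 v /choice[g /choice[h hgh]].
pose gv : FF p.+1 := [ffun b => g b]; pose hv : FF p.+1 := [ffun b => h b].
have ev : gmap v = hv + fscale l gv.
  by apply/ffunP => b; rewrite !ffunE; have [_ <-] := hgh b; rewrite ffunE.
have Jh b : J (hv b) by rewrite ffunE; case: (hgh b).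
have [|w [u [Ju eg]]] := ex0 gv.
  move=> c; apply: lreg.
  have := gmap_comp v; rewrite ev gmapD gmap_scale => /ffunP/(_ c).
  rewrite [in LHS]ffunE [in X in _ + X]ffunE [in RHS]ffunE => /eqP.
  rewrite addrC addr_eq0 => /eqP ->; apply: idealN => //.
  exact: gmap_ideal.
have [|w2 [u2 [Ju2 e2]]] := ex1 (v - fscale l w).
  move=> b; rewrite gmapD gmapN gmap_scale ev.
  have -> : hv + fscale l gv - fscale l (gmap w) = hv + fscale l u.
    by rewrite eg; apply/ffunP => a; rewrite !ffunE; ring.
  by rewrite !ffunE; apply: idealD => //; [have [] := hgh b | apply: idealM].
exists w2, (u2 + fscale l w); split=> [a|]; last by rewrite addrA -e2 subrK.
by exists (w a), (u2 a); rewrite !ffunE.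
Qed.

End Syzygies.

(** A closed field is infinite: a root of q + 1, with q vanishing on s, avoids s. *)
Lemma exists_notin (k : closedFieldType) (s : seq k) : exists b, b \notin s.
Proof.
pose q : {poly k} := \prod_(a <- 0 :: s) ('X - a%:P).
have sq : size q = (size s).+2 by rewrite size_prod_XsubC.
have [b /rootP] : exists b, root (q + 1) b.
  by apply/closed_rootP; rewrite size_polyDl sq // size_poly1.
rewrite hornerD hornerC => e; exists b; apply/negP => bs.
have /rootP qb : root q b by rewrite root_prod_XsubC inE bs orbT.
by move: e; rewrite qb add0r => /eqP; rewrite oner_eq0.
Qed.

Section Length.
Variables (k : closedFieldType) (X : seq (P1xP1 k)) (F : gcomplex k).
Local Notation x j := ('X_(lshift 2 j) : cox k).
Local Notation y j := ('X_(rshift 2 j) : cox k).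
Local Notation FF p := {ffun gen F p -> cox k}.

Lemma bihomog_linx (b : k) : bihomog (1, 0) (x 0 - b%:MP * x 1).
Proof.
apply: bihomogB; first exact: (bihomogX k (lshift 2 0)).
by apply: bihomogZ; exact: (bihomogX k (lshift 2 1)).
Qed.

Lemma exists_linx : exists b : k,
  forall p, p \in X -> (x 0 - b%:MP * x 1).@[coords p] != 0.
Proof.
pose u (p : P1xP1 k) j := vpick (line p.1) 0 j.
have [b hb] := exists_notin [seq u p 0 / u p 1 | p <- X].
exists b => p pX; rewrite mevalB mevalM mevalC !mevalXU /coords !row_mxEl.
rewrite -/(u p 0) -/(u p 1) subr_eq0; have [u1|u1] := eqVneq (u p 1) 0.
  rewrite u1 mulr0; have [/rV0Pn[j] u0 _] := line_pick p.1.
  by move: u0; have [->|->] := ord2P j; rewrite // -/(u p 1) u1 eqxx.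
apply: contra hb => /eqP e; apply/mapP; exists p => //.
by rewrite e mulfK.
Qed.

Lemma augment_scale (M : gmodule k) (eps : gen F 0 -> M) l (v : FF 0) :
  augment eps (fscale l v) = l *: augment eps v.
Proof. by rewrite /augment scaler_sumr; apply: eq_bigr => b _; rewrite ffunE scalerA. Qed.

Hypothesis F_res : min_free_res F (coord_ring X).

Lemma exact_mod0 p : exact_mod F (fun f => f = 0) p.
Proof.
have [_ [_ _ _ ex _]] := F_res; move=> v hv.
have [|w ->] := (ex p v).1; first by apply/ffunP => b; rewrite hv ffunE.
by exists w, 0; split=> [a|]; rewrite ?ffunE ?addr0.
Qed.

Lemma zero_ideal : is_ideal (fun f : cox k => f = 0).
Proof. by split=> [|f g -> ->|f g ->]; rewrite ?subr0 ?mulr0. Qed.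

(** The chase of [exact_mod_adjoin] one step lower, where M = S / I_X takes the place
    of the missing term of F: it works because l is also regular on M.  This is the
    gain of one over Hilbert's syzygy theorem. *)
Lemma exact_mod_form0 d l : bihomog d l -> (forall p, p \in X -> l.@[coords p] != 0) ->
  exact_mod F (adjoin (fun f => f = 0) l) 0.
Proof.
move=> hl l0; have [eps [_ _ ex0 ex _]] := F_res.
move=> v /choice[g /choice[h hgh]].
pose gv : FF 0 := [ffun b => g b].
have ev : gmap v = fscale l gv.
  by apply/ffunP => b; rewrite [RHS]ffunE [gv b]ffunE; have [-> ->] := hgh b; rewrite add0r.
have /ex0[w eg] : augment eps gv = 0.
  apply: (form_regular hl l0); rewrite -augment_scale -ev.
  by apply/ex0; exists v.
have /ex[w2 e2] : gmap (v - fscale l w) = 0 :> FF 0.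
  by rewrite gmapD gmapN gmap_scale ev eg subrr.
exists w2, (fscale l w); rewrite -e2 subrK; split=> // a.
by exists (w a), 0; rewrite ffunE add0r.
Qed.

(** The forms l, x_1, y_0, y_1 generate the ideal of the polynomials without constant
    term and form a regular sequence on S.  Exactness modulo l holds at F_1, and each
    of the other three forms costs one degree. *)
Lemma exact_mod_max p : exact_mod F (fun f => f@_0%MM = 0) p.+3.
Proof.
have [b hb] := exists_linx.
pose l := x 0 - b%:MP * x 1.
pose J0 := fun f : cox k => f = 0.
pose J1 := adjoin J0 l; pose J2 := adjoin J1 (x 1).
pose J3 := adjoin J2 (y 0); pose J4 := adjoin J3 (y 1).
have I0 : is_ideal J0 := zero_ideal.
have I1 : is_ideal J1 by apply: adjoin_ideal.
have I2 : is_ideal J2 by apply: adjoin_ideal.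
have I3 : is_ideal J3 by apply: adjoin_ideal.
have I4 : is_ideal J4 by apply: adjoin_ideal.
have J2x j : J2 (x j).
  case: (ord2P j) => ->; last exact: adjoin_gen.
  have -> : x 0 = l + b%:MP * x 1 by rewrite /l subrK.
  apply: idealD => //; first exact/adjoin_sub/adjoin_gen.
  by apply: idealM => //; apply: adjoin_gen.
have J4y j : J4 (y j).
  by case: (ord2P j) => ->; [apply/adjoin_sub/adjoin_gen | apply: adjoin_gen].
have Xn0 i : 'X_i != 0 :> cox k.
  by apply/eqP => /(congr1 (mcoeff U_(i)%MM))/eqP; rewrite mcoeffX eqxx mcoeff0 oner_eq0.
have l_neq0 : l != 0.
  apply/eqP => /(congr1 (subst_mpoly (fun j => (j == 0)%:R) (fun j => y j))) /eqP.
  rewrite /subst_mpoly rmorphB rmorphM rmorph0 /= -!/(subst_mpoly _ _ _) !subst_mpoly_x /=.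
  by rewrite mulr0 subr0 oner_eq0.
(* J1 is the kernel of x_0 := b x_1, J2 that of x_0 := 0, x_1 := 0, and J3 that of
   x_0 := 0, x_1 := 0, y_0 := 0; [A1] and [B3] give the values of the first and third. *)
pose A1 (j : 'I_2) := b%:MP ^+ (j == 0) * x 1.
pose B3 (j : 'I_2) := if j == 0 then 0 else y 1.
have r1 f : J0 (l * f) -> J0 f by move/eqP; rewrite mulf_eq0 (negPf l_neq0) => /eqP.
have r2 f : J1 (x 1 * f) -> J1 f.
  apply: (@regular_mod_subst k J1 A1 (fun j => y j)) => //.
  - move=> j; rewrite /A1; case: (ord2P j) => -> /=; first exact: adjoin_gen.
    by rewrite mul1r subrr; apply: ideal0.
  - by move=> j; rewrite subrr; apply: ideal0.
  - move=> g [g1 [_ [-> ->]]]; rewrite add0r /subst_mpoly rmorphM rmorphB rmorphM /=.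
    rewrite comp_mpolyC -!/(subst_mpoly _ _ _) !subst_mpoly_x /A1 /= expr1 expr0 mul1r subrr.
    by rewrite mul0r.
  - by rewrite subst_mpoly_x /A1 /= expr0 mul1r Xn0.
have r3 f : J2 (y 0 * f) -> J2 f.
  apply: (@regular_mod_subst k J2 (fun=> 0) (fun j => y j)) => //.
  - by move=> j; rewrite subr0.
  - by move=> j; rewrite subrr; apply: ideal0.
  - move=> g [g2 [_ [[g1 [_ [-> ->]]] ->]]].
    rewrite add0r /subst_mpoly rmorphD !rmorphM rmorphB rmorphM /= -!/(subst_mpoly _ _ _).
    rewrite !subst_mpoly_x.
    by rewrite mulr0 subrr !mul0r addr0.
  - by rewrite subst_mpoly_y Xn0.
have r4 f : J3 (y 1 * f) -> J3 f.
  apply: (@regular_mod_subst k J3 (fun=> 0) B3) => //.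
  - by move=> j; rewrite subr0; apply: adjoin_sub.
  - move=> j; rewrite /B3; case: (ord2P j) => -> /=.
      by rewrite subr0; apply: adjoin_gen.
    by rewrite subrr; apply: ideal0.
  - move=> g [g3 [_ [[g2 [_ [[g1 [_ [-> ->]]] ->]]] ->]]].
    rewrite add0r /subst_mpoly !rmorphD !rmorphM rmorphB rmorphM /= -!/(subst_mpoly _ _ _).
    by rewrite !subst_mpoly_x subst_mpoly_y /B3 /= mulr0 subrr !mul0r !addr0.
  - by rewrite subst_mpoly_y /B3 /= Xn0.
have e1 q : exact_mod F J1 q.
  case: q => [|q]; first exact: exact_mod_form0 (bihomog_linx b) hb.
  by apply: exact_mod_adjoin => //; apply: exact_mod0.
have e2 q : exact_mod F J2 q.+1 by apply: exact_mod_adjoin.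
have e3 q : exact_mod F J3 q.+2 by apply: exact_mod_adjoin.
have e4 q : exact_mod F J4 q.+3 by apply: exact_mod_adjoin.
have X0 i : ('X_i : cox k)@_0%MM = 0.
  by rewrite mcoeffX (_ : _ == _ = false) //; apply/eqP => /mnmP/(_ i); rewrite mnm1E eqxx mnm0E.
(* The constant term of f is its image under the substitution of 0 for all variables. *)
have JE f : J4 f <-> f@_0%MM = 0.
  split=> [[g4 [_ [[g3 [_ [[g2 [_ [[g1 [_ [-> ->]]] ->]]] ->]]] ->]]]|f0].
    by rewrite add0r !rmorphD !rmorphM rmorphB rmorphM /= !X0 mulr0 subrr !mul0r !addr0.
  rewrite -[f]subr0 -[X in _ - X]mpolyC0 -f0.
  have -> : (f@_0%MM)%:MP = subst_mpoly (fun=> 0) (fun=> 0) f.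
    rewrite /subst_mpoly comp_mpolyEX [in LHS](mpolyE f) raddf_sum /= rmorph_sum /=.
    apply: eq_bigr => m _; rewrite mcoeffZ mcoeffX mpolyCM mul_mpolyC; congr (_ *: _).
    rewrite comp_mpolyX; have [->|m0] := eqVneq m 0%MM.
      by rewrite big1 ?mpolyC1 // => i _; rewrite mnm0E expr0.
    have [i mi] : exists i, m i != 0%N.
      apply/existsP; apply: contraNT m0; rewrite negb_exists => /forallP h.
      by apply/eqP/mnmP => i; rewrite mnm0E; apply/eqP; rewrite -[_ == _]negbK.
    rewrite (bigD1 i) //= tnth_mktuple mpolyC0.
    by case: split => _; rewrite expr0n (negPf mi) mul0r.
  apply: ideal_subst => // j; rewrite subr0 //.
  exact/adjoin_sub/adjoin_sub.
move=> v hv; have [|w [u [Ju e]]] := e4 p v; first by move=> c; apply/JE/hv.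
by exists w, u; split=> // a; apply/JE.
Qed.

(** Minimality makes the differential of F modulo the maximal ideal zero, while
    [exact_mod_max] makes it exact from F_4 on: so F_p modulo that ideal is 0. *)
Lemma gen_empty p : #|gen F p.+4| = 0%N.
Proof.
have [_ [_ _ _ _ min]] := F_res.
have gm0 q (v : FF q.+1) c : ((gmap v : FF q) c)@_0%MM = 0.
  rewrite ffunE raddf_sum big1 //= => a _.
  by rewrite rmorphM /= min mulr0.
apply: eq_card0 => a; apply/negP => _.
pose v : FF p.+4 := [ffun a' => (a' == a)%:R].
have [|w [u [hu e]]] := @exact_mod_max p v; first exact: gm0.
have /ffunP/(_ a)/(congr1 (mcoeff 0%MM)) := e.
rewrite [v a]ffunE eqxx [in RHS]ffunE mcoeffD hu gm0 addr0 mcoeff1 eqxx.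
by move/eqP; rewrite oner_eq0.
Qed.

End Length.

(** * The Euler characteristic of a graded strand *)

(** The monomial x_0^j x_1^(a-j) y_0^j' y_1^(b-j'). *)
Definition mon (a b j j' : nat) : 'X_{1..2 + 2} :=
  [multinom match split i with
    | inl c => if c == ord0 then j else (a - j)%N
    | inr c => if c == ord0 then j' else (b - j')%N end | i < 2 + 2].

Lemma mon_x a b j j' c : mon a b j j' (lshift 2 c) = if c == ord0 then j else (a - j)%N.
Proof. by rewrite mnmE (unsplitK (inl c)). Qed.

Lemma mon_y a b j j' c : mon a b j j' (rshift 2 c) = if c == ord0 then j' else (b - j')%N.
Proof. by rewrite mnmE (unsplitK (inr c)). Qed.

Definition monomials (d : int * int) : seq 'X_{1..2 + 2} :=
  if (0 <= d.1) && (0 <= d.2) then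
    [seq mon `|d.1| `|d.2| j j' | j <- iota 0 `|d.1|.+1, j' <- iota 0 `|d.2|.+1]
  else [::].

Lemma monomialsE (a b : nat) : monomials (a%:Z, b%:Z) =
  [seq mon a b j j' | j <- iota 0 a.+1, j' <- iota 0 b.+1].
Proof. by []. Qed.

Lemma monomials_uniq d : uniq (monomials d).
Proof.
rewrite /monomials; case: ifP => // _; apply: allpairs_uniq; rewrite ?iota_uniq //.
move=> [j j'] [l l'] _ _ /= /mnmP e; congr pair.
  by have := e (lshift 2 0); rewrite !mon_x.
by have := e (rshift 2 0); rewrite !mon_y.
Qed.

Lemma bidegE (m : 'X_{1..2 + 2}) : bideg m =
  ((m (lshift 2 0%R) + m (lshift 2 1%R))%N%:Z, (m (rshift 2 0%R) + m (rshift 2 1%R))%N%:Z).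
Proof.
rewrite /bideg !big_ord_recl !big_ord0 !addn0.
by congr (Posz (_ + m _), Posz (_ + m _)); apply: val_inj.
Qed.

Lemma mem_monomials d m : (m \in monomials d) = (bideg m == d).
Proof.
apply/idP/eqP.
  rewrite /monomials; case: ifP => // /andP[d1 d2] /allpairsP[[j j'] []].
  rewrite !mem_iota !add0n !ltnS => hj hj' ->.
  rewrite bidegE !mon_x !mon_y /= in hj hj' *.
  by rewrite !subnKC //; case: d d1 d2 {hj hj'} => [[a|a] [b|b]].
move=> <-; rewrite bidegE monomialsE; apply/allpairsP.
exists (m (lshift 2 0), m (rshift 2 0)); rewrite !mem_iota !add0n !ltnS !leq_addr; split=> //=.
apply/mnmP => i; case: (split_ordP i) => c ->; rewrite ?mon_x ?mon_y.
  by have [->|->] := ord2P c; rewrite //= addKn.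
by have [->|->] := ord2P c; rewrite //= addKn.
Qed.

Definition dimS (a b : int) : int :=
  (if 0 <= a then a + 1 else 0) * (if 0 <= b then b + 1 else 0).

Lemma size_monomials d : (size (monomials d))%:Z = dimS d.1 d.2.
Proof.
case: d => [[a|a] [b|b]]; rewrite ?monomialsE /dimS ?mul0r ?mulr0 //.
by rewrite size_allpairs !size_iota PoszM -[a.+1]addn1 -[b.+1]addn1 !PoszD.
Qed.

(** The rank-nullity theorem at an exact spot; the maps act on row vectors. *)
Lemma exact_rank (k : fieldType) m n l (A : 'M[k]_(m, n)) (B : 'M[k]_(l, m)) :
  (forall v : 'rV_m, v *m A = 0 <-> exists w, v = w *m B) ->
  (\rank A + \rank B = m)%N.
Proof.
move=> ex; have -> : \rank B = \rank (kermx A).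
  apply/eqmx_rank/andP; split; apply/rV_subP => v.
    by move=> /submxP[w e]; apply/sub_kermxP/ex; exists w.
  by move=> /sub_kermxP/ex[w ->]; apply: submxMl.
by rewrite mxrank_ker subnKC // rank_leq_row.
Qed.

Lemma mul_linear_mx (k : fieldType) m n (f : 'rV[k]_m -> 'rV[k]_n) : linear f ->
  forall v, v *m lin1_mx f = f v.
Proof.
move=> fl v; pose fL : {linear 'rV[k]_m -> 'rV[k]_n} :=
  HB.pack f (GRing.isLinear.Build _ _ _ _ f fl).
exact: (mul_rV_lin1 fL v).
Qed.

Section Strand.
Variables (k : closedFieldType) (F : gcomplex k) (r : int * int).
Local Notation FF p := {ffun gen F p -> cox k}.

(** A monomial basis of the degree r part of F_p. *)
Definition strand p : seq (gen F p * 'X_{1..2 + 2}) :=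
  [seq (a, m) | a <- enum (gen F p), m <- monomials (r - gdeg a)].

Lemma strand_uniq p : uniq (strand p).
Proof.
apply: allpairs_uniq_dep; first exact: enum_uniq.
  by move=> a _; apply: monomials_uniq.
by move=> [a m] [b n] _ _ /= [-> ->].
Qed.

Lemma mem_strand p a m : ((a, m) \in strand p) = (bideg m == r - gdeg a).
Proof.
rewrite -mem_monomials; apply/allpairsPdep/idP => [[b [n [_ mn [-> ->]]]] //|h].
by exists a, m; rewrite mem_enum.
Qed.

Lemma size_strand p : (size (strand p))%:Z =
  \sum_(a : gen F p) dimS (r.1 - (gdeg a).1) (r.2 - (gdeg a).2).
Proof.
rewrite size_allpairs_dep sumnE big_map big_enum /= -natz natr_sum.
by apply: eq_bigr => a _; rewrite natz size_monomials.
Qed.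

Local Notation N p := (size (strand p)).
Local Notation bas i := (tnth (in_tuple (strand _)) i).

Definition ofvec p (v : 'rV[k]_(N p)) : FF p :=
  [ffun a => \sum_i v 0 i *: (((bas i).1 == a)%:R *: 'X_[(bas i).2])].
Definition tovec p (w : FF p) : 'rV[k]_(N p) := \row_i (w (bas i).1)@_((bas i).2).
Definition homogF p (w : FF p) := forall a, bihomog (r - gdeg a) (w a).

Lemma ofvec_homog p (v : 'rV[k]_(N p)) : homogF (ofvec v).
Proof.
move=> a; apply/bihomogP => m; rewrite ffunE raddf_sum /=.
apply: contraNeq => ma; rewrite big1 // => i _.
rewrite !mcoeffZ mcoeffX; have [e1|_] := eqVneq (bas i).1 a; last by rewrite mul0r mulr0.
have [e2|_] := eqVneq (bas i).2 m; last by rewrite !mulr0.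
have := mem_tnth i (in_tuple (strand p)); rewrite [bas i]surjective_pairing mem_strand.
by rewrite e1 e2 (negPf ma).
Qed.

Lemma ofvecK p : cancel (@ofvec p) (@tovec p).
Proof.
move=> v; apply/rowP => i; rewrite mxE ffunE raddf_sum (bigD1 i) //=.
rewrite !mcoeffZ mcoeffX !eqxx !mulr1 big1 ?addr0 // => j ji.
rewrite !mcoeffZ mcoeffX -natrM mulnb -xpair_eqE -!surjective_pairing.
by rewrite (inj_eq (tuple_uniqP (in_tuple (strand p)) (strand_uniq p))) (negPf ji) mulr0.
Qed.

Lemma tovec0 p : tovec (0 : FF p) = 0.
Proof. by apply/rowP => i; rewrite !mxE ffunE mcoeff0. Qed.

Lemma ofvec0 p : ofvec (0 : 'rV_(N p)) = 0.
Proof.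
apply/ffunP => a; rewrite !ffunE big1 // => i _.
by rewrite mxE scale0r.
Qed.

Lemma tovecK p (w : FF p) : homogF w -> ofvec (tovec w) = w.
Proof.
move=> hw; apply/ffunP => a; apply/mpolyP => m; rewrite ffunE raddf_sum /=.
have [ma|ma] := boolP ((a, m) \in strand p); last first.
  rewrite big1 => [|i _]; last first.
    rewrite !mcoeffZ mcoeffX -natrM mulnb -xpair_eqE -surjective_pairing.
    rewrite [_ == _](_ : _ = false) ?mulr0 //.
    by apply: contraNF ma => /eqP <-; apply: (mem_tnth i (in_tuple (strand p))).
  apply/esym/eqP; apply: contraR ma => /(bihomogP _ _ (hw a)) e.
  by rewrite mem_strand e.
have /(tnthP (in_tuple (strand p)))[i ei] := ma.
rewrite (bigD1 i) //= !mcoeffZ mcoeffX mxE -ei !eqxx !mulr1 big1 ?addr0 // => j ji.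
rewrite !mcoeffZ mcoeffX -natrM mulnb -xpair_eqE -surjective_pairing ei.
by rewrite (inj_eq (tuple_uniqP (in_tuple (strand p)) (strand_uniq p))) (negPf ji) mulr0.
Qed.

Lemma ofvec_linear p c (v w : 'rV[k]_(N p)) : ofvec (c *: v + w) = c *: ofvec v + ofvec w.
Proof.
apply/ffunP => a; rewrite !ffunE scaler_sumr -big_split; apply: eq_bigr => i _ /=.
by rewrite !mxE scalerDl scalerA.
Qed.

Lemma tovec_linear p c (v w : FF p) : tovec (c *: v + w) = c *: tovec v + tovec w.
Proof. by apply/rowP => i; rewrite !mxE !ffunE mcoeffD mcoeffZ. Qed.

Lemma gmap_linear p c (v w : FF p.+1) : gmap (c *: v + w) = c *: gmap v + gmap w :> FF p.
Proof.
apply/ffunP => b; rewrite !ffunE scaler_sumr -big_split; apply: eq_bigr => a _ /=.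
by rewrite !ffunE mulrDl scalerAl.
Qed.

Definition hcompF p (w : FF p) : FF p := [ffun a => hcomp (r - gdeg a) (w a)].

Lemma hcompF_homog p (w : FF p) : homogF (hcompF w).
Proof. by move=> a; rewrite ffunE; apply: bihomog_hcomp. Qed.

Lemma hcompF_id p (w : FF p) : homogF w -> hcompF w = w.
Proof. by move=> hw; apply/ffunP => a; rewrite ffunE (hcomp_bihomog _ (hw a)) eqxx. Qed.

Lemma hcompF_gmap p (w : FF p.+1) : hcompF (gmap w : FF p) = gmap (hcompF w).
Proof.
apply/ffunP => b; rewrite !ffunE raddf_sum /=; apply: eq_bigr => a _.
rewrite ffunE (hcompM _ _ (gdiff_homog a b)); congr (hcomp _ _ * _).
by rewrite opprB addrA subrK.
Qed.

Lemma gmap_homog p (w : FF p.+1) : homogF w -> homogF (gmap w : FF p).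
Proof. by move=> hw; rewrite -(hcompF_id hw) -hcompF_gmap; apply: hcompF_homog. Qed.

Definition strand_diff p : 'M[k]_(N p.+1, N p) :=
  lin1_mx (fun v => tovec (gmap (ofvec v))).

Lemma strand_diffE p (v : 'rV_(N p.+1)) : v *m strand_diff p = tovec (gmap (ofvec v)).
Proof.
by apply: mul_linear_mx => c u w; rewrite ofvec_linear gmap_linear tovec_linear.
Qed.

Section Resolution.
Variable X : seq (P1xP1 k).
Local Notation M := (coord_ring X).

Lemma gmap_strand p (v : 'rV_(N p)) :
  (exists w : FF p.+1, ofvec v = gmap w) <-> exists w, v = w *m strand_diff p.
Proof.
split=> [[w e]|[w ->]].
  exists (tovec (hcompF w)); rewrite strand_diffE tovecK; last exact: hcompF_homog.
  by rewrite -hcompF_gmap -e hcompF_id ?ofvecK //; apply: ofvec_homog.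
exists (ofvec w); rewrite strand_diffE tovecK //.
exact/gmap_homog/ofvec_homog.
Qed.

Lemma strand_exact p : (forall v : FF p.+1, gmap v = 0 :> FF p <-> exists w, v = gmap w) ->
  (\rank (strand_diff p) + \rank (strand_diff p.+1) = N p.+1)%N.
Proof.
move=> ex; apply: exact_rank => v; rewrite -gmap_strand -ex strand_diffE.
split=> [/(congr1 (@ofvec p))|->]; last exact: tovec0.
by rewrite tovecK ?ofvec0 //; apply/gmap_homog/ofvec_homog.
Qed.

Lemma augment_linear (eps : gen F 0 -> M) c v w :
  augment eps (c *: v + w) = c%:MP *: augment eps v + augment eps w.
Proof.
rewrite /augment scaler_sumr -big_split; apply: eq_bigr => b _.
by rewrite !ffunE -mul_mpolyC scalerDl scalerA.
Qed.

Lemma augment_part (eps : gen F 0 -> M) (v : FF 0) :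
  (forall b, gm_part (gdeg b) (eps b)) -> homogF v -> gm_part r (augment eps v).
Proof.
move=> heps hv; apply: gm_part_sum => b _.
by rewrite -[r](subrK (gdeg b)); apply: gm_partZ.
Qed.

(** The augmentation respects the grading, so it may be applied to the degree r part
    of v only, when the result lies in degree r. *)
Lemma augment_hcompF (eps : gen F 0 -> M) (v : FF 0) :
  (forall b, gm_part (gdeg b) (eps b)) -> gm_part r (augment eps v) ->
  augment eps (hcompF v) = augment eps v.
Proof.
move=> heps [f hf ef]; have /choice[g hg] : forall b, exists g : cox k,
    bihomog (gdeg b) g /\ eps b = (\pi_{ideal_quot IX X} g)%qT.
  by move=> b; have [g] := heps b; exists g.
have augE w : augment eps w = (\pi_{ideal_quot IX X} (\sum_b w b * g b))%qT.
  rewrite raddf_sum /=; apply: eq_bigr => b _; rewrite (hg b).2.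
  exact: quot_scale_pi.
rewrite ef augE; apply/piQ_eq; rewrite -opprB rpredN.
have hcomp_aug : hcomp r (\sum_b v b * g b) = \sum_b hcompF v b * g b.
  rewrite raddf_sum /=; apply: eq_bigr => b _.
  by rewrite (hcompM _ _ (hg b).1) ffunE.
move: ef; rewrite augE => /esym/piQ_eq/(IX_hcomp r).
by rewrite raddfB /= (hcomp_bihomog _ hf) eqxx hcomp_aug.
Qed.

(** Coordinates in a basis of M_r turn the augmentation into a matrix, which has full
    rank because the augmentation is onto in each degree. *)
Lemma strand_exact0 (eps : gen F 0 -> M) m : (forall b, gm_part (gdeg b) (eps b)) ->
  (forall u : M, exists v, u = augment eps v) ->
  (forall v, augment eps v = 0 <-> exists w, v = @gmap k F 0 w) ->
  part_has_dim M r m -> (m + \rank (strand_diff 0) = N 0)%N.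
Proof.
move=> heps eps_surj ex [e [he hfree hspan]].
pose lc (c : 'rV[k]_m) : M := \sum_j (c 0 j)%:MP *: e j.
have lc_linear a c d : lc (a *: c + d) = a%:MP *: lc c + lc d.
  rewrite /lc scaler_sumr -big_split; apply: eq_bigr => j _ /=.
  by rewrite !mxE mpolyCD mpolyCM scalerDl scalerA.
have lc0 : lc 0 = 0.
  by rewrite /lc big1 // => j _; rewrite mxE mpolyC0 scale0r.
have lc_inj c d : lc c = lc d -> c = d.
  move=> cd; apply/eqP; rewrite -subr_eq0; apply/eqP/rowP => j; rewrite [RHS]mxE.
  apply: (hfree (fun j => (c - d) 0 j)); rewrite -/(lc (c - d)).
  by rewrite -[c - d]addrC -scaleN1r lc_linear cd mpolyCN mpolyC1 scaleN1r addNr.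
have /choice[f hf] : forall v, exists c, augment eps (ofvec v) = lc c.
  move=> v; have [c ec] := hspan _ (augment_part heps (ofvec_homog v)).
  by exists (\row_j c j); rewrite ec; apply: eq_bigr => j _; rewrite mxE.
have f_linear : linear f.
  move=> a v w; apply: lc_inj; rewrite -hf ofvec_linear augment_linear !hf.
  by rewrite lc_linear.
have fE := mul_linear_mx f_linear.
have -> : m = \rank (lin1_mx f).
  apply/esym/eqP; rewrite -[_ == _]/(row_full _) -sub1mx; apply/row_subP => i.
  set c := row i _; apply/submxP.
  have [w ew] := eps_surj (lc c).
  have hw : gm_part r (augment eps w).
    rewrite -ew; apply: gm_part_sum => j _; rewrite -[r]add0r.
    by apply: gm_partZ; [apply: bihomogC | apply: he].
  exists (tovec (hcompF w)); rewrite fE; apply: lc_inj.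
  by rewrite -hf tovecK ?augment_hcompF //; apply: hcompF_homog.
apply: exact_rank => v; rewrite -gmap_strand -ex fE hf.
by split=> [->|e0]; [exact: lc0 | apply: lc_inj; rewrite lc0].
Qed.

(** The four rank equations of the degree r strand, with no ranks left after
    elimination. *)
Lemma strand_euler m : min_free_res F M -> part_has_dim M r m -> #|gen F 4| = 0%N ->
  (m + N 1 + N 3 = N 0 + N 2)%N.
Proof.
move=> [eps [heps eps_surj ex0 ex _]] dimM F4.
have N4 : N 4 = 0%N.
  by rewrite size_allpairs_dep (size0nil (_ : size (enum _) = 0%N)) // -cardE.
have e0 := strand_exact0 heps eps_surj ex0 dimM.
have e1 := strand_exact (ex 0%N); have e2 := strand_exact (ex 1%N).
have e3 := strand_exact (ex 2).
have r3 : \rank (strand_diff 3) = 0%N.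
  by apply/eqP; rewrite -leqn0; apply: leq_trans (rank_leq_row _) _; rewrite N4.
rewrite r3 addn0 in e3; move: e0 e1 e2 e3.
move: (\rank (strand_diff 0)) (\rank (strand_diff 1)) (\rank (strand_diff 2)).
move=> r0 r1 r2 <- <- <- <-; lia.
Qed.

End Resolution.
End Strand.

(** A positive value of [part_dim] cannot be its default value 0; outside N^2 both
    sides are 0 as there are no forms. *)
Lemma part_has_dim_hilb (k : closedFieldType) (X : seq (P1xP1 k)) (i i' : int) :
  uniq X -> generic_hilb X -> (0 < size X)%N ->
  exists2 m, part_has_dim (coord_ring X) (i, i') m & hilb X i i' = m%:Z.
Proof.
move=> uX gX n0; rewrite /hilb; have [/andP[i0 i'0]|neg] := boolP (_ && _).
  exists (part_dim (coord_ring X) (i, i')) => //; apply: part_dimP.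
  case: i i0 => // a _; case: i' i'0 => // b _.
  have := gX a b; rewrite /hilb /= undup_id // => -[->].
  by rewrite leq_min n0.
exists 0%N => //; exists (fun=> 0); split=> [[]|c _ []|u [f hf ->]] //.
exists (fun=> 0); rewrite big_ord0 (bihomog_neg hf) ?raddf0 //=.
by move: neg; lia.
Qed.

Lemma diff_op_sum (I : finType) (T : I -> int -> int -> int) :
  diff_op (fun i i' => \sum_a T a i i') = fun i i' => \sum_a diff_op (T a) i i'.
Proof.
by apply/funext => i; apply/funext => i'; rewrite /diff_op -big_split -!sumrB.
Qed.

(** The generating function of the dimensions of S is 1 / ((1 - s)^2 (1 - t)^2), and the
    second difference multiplies it by (1 - s)^2 (1 - t)^2.  In terms of values, the
    dimension is a product of two ramps, and the second difference of a ramp is a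
    unit impulse. *)
Lemma diff_op2_dimS (c d i i' : int) :
  diff_op (diff_op (fun i i' => dimS (i - c) (i' - d))) i i' = ((c, d) == (i, i'))%:R.
Proof.
pose s (a : int) := if 0 <= a then a + 1 else 0.
have sE a : s a - s (a - 1) *+ 2 + s (a - 1 - 1) = (a == 0)%:R.
  by rewrite /s mulr2n; do 3 case: ifP => ?; case: eqP => ? /=; lia.
rewrite xpair_eqE -mulnb natrM ![_ == i]eq_sym ![_ == i']eq_sym.
rewrite -![_ == c]subr_eq0 -![_ == d]subr_eq0 -!sE.
rewrite /diff_op /dimS -!/(s _) ![_ - 1 - c]addrAC ![_ - 1 - d]addrAC.
by ring.
Qed.

(** Additivity of dimension along the resolution, followed by [diff_op2_dimS] on each
    summand of F. *)
Lemma hilb_diff2_betti (k : closedFieldType) (X : seq (P1xP1 k)) (F : gcomplex k)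
    (i i' : int) : uniq X -> generic_hilb X -> (0 < size X)%N ->
  min_free_res F (coord_ring X) ->
  hilb_diff2 X i i' = (betti F 0 (i, i'))%:Z - (betti F 1 (i, i'))%:Z
    + (betti F 2 (i, i'))%:Z - (betti F 3 (i, i'))%:Z.
Proof.
move=> uX gX n0 F_res.
pose T p (a : gen F p) (i i' : int) := dimS (i - (gdeg a).1) (i' - (gdeg a).2).
pose S p i i' := \sum_(a : gen F p) T p a i i'.
have hilbE : hilb X = fun i i' => S 0%N i i' - S 1%N i i' + S 2 i i' - S 3 i i'.
  apply/funext => j; apply/funext => j'.
  have [m dimM ->] := part_has_dim_hilb j j' uX gX n0.
  have SE p : S p j j' = (size (strand F (j, j') p))%:Z by rewrite size_strand.
  have := strand_euler F_res dimM (gen_empty F_res 0); rewrite !SE.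
  move: (size _) (size _) (size _) (size _) => a b c d; lia.
have diff2S p : diff_op (diff_op (S p)) i i' = (betti F p (i, i'))%:Z.
  rewrite diff_op_sum diff_op_sum /betti -sum1_card -natz natr_sum [in RHS]big_mkcond /=.
  apply: eq_bigr => a _; rewrite diff_op2_dimS -surjective_pairing inE.
  by case: (_ == _).
rewrite -!diff2S /hilb_diff2 hilbE /diff_op.
by ring.
Qed.

(** * Second differences of a generic Hilbert function *)

Section CornerEntry.
Variables (k : closedFieldType) (X : seq (P1xP1 k)) (i i' : int).
Hypotheses (uX : uniq X) (gX : generic_hilb X).
Local Notation n := ((size X)%:Z).
Local Notation h := (hilb X).

Lemma hilb_full a b : 0 <= a -> 0 <= b -> n <= (a + 1) * (b + 1) -> h a b = n.
Proof.
case: a b => [a|//] [b|//] _ _ ab; rewrite gX undup_id //; congr Posz; apply/minn_idPl.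
by rewrite -lez_nat PoszM -[a.+1]addn1 -[b.+1]addn1 !PoszD.
Qed.

Lemma hilb_small a b : 0 <= a -> 0 <= b -> (a + 1) * (b + 1) <= n ->
  h a b = (a + 1) * (b + 1).
Proof.
case: a b => [a|//] [b|//] _ _ ab; rewrite gX undup_id //.
have e : (a.+1 * b.+1)%N%:Z = (a%:Z + 1) * (b%:Z + 1).
  by rewrite PoszM -[a.+1]addn1 -[b.+1]addn1 !PoszD.
by rewrite -e; congr Posz; apply/minn_idPr; rewrite -lez_nat e.
Qed.

Lemma hilb_le a b : h a b <= n.
Proof.
case: a b => [a|a] [b|b] //; rewrite gX undup_id // lez_nat; exact: geq_minl.
Qed.

Hypotheses (i1 : 1 <= i) (ii : i <= i').
Hypotheses (b1 : i * (i' + 1) < n) (b2 : (i + 1) * i' < n) (b3 : n < i * (i' + 2)).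

(** Of the nine values of the Hilbert function that enter, six equal n and the three
    others count all forms. *)
Lemma hilb_diff2_corner :
  hilb_diff2 X (i + 1) (i' + 1) = 3 * n - 3 * i * i' - 2 * i - 2 * i'.
Proof.
rewrite /hilb_diff2 /diff_op !addrK.
have -> : h (i + 1) (i' + 1) = n by apply: hilb_full; nia.
have -> : h i (i' + 1) = n by apply: hilb_full; nia.
have -> : h (i - 1) (i' + 1) = n by apply: hilb_full; nia.
have -> : h (i + 1) i' = n by apply: hilb_full; nia.
have -> : h i i' = n by apply: hilb_full; nia.
have -> : h (i + 1) (i' - 1) = n by apply: hilb_full; nia.
have -> : h (i - 1) i' = i * (i' + 1) by rewrite hilb_small ?subrK //; lia.
have -> : h i (i' - 1) = (i + 1) * i' by rewrite hilb_small ?subrK //; lia.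
have -> : h (i - 1) (i' - 1) = i * i' by rewrite hilb_small ?subrK //; nia.
by ring.
Qed.

(** The coefficients of the nine values add up to 0, and all values are n except
    possibly the one at (i - 1, s' - 2), which has coefficient 1 and is at most n. *)
Lemma hilb_diff2_row s' : i' + 1 < s' -> hilb_diff2 X (i + 1) s' <= 0.
Proof.
move=> hs; rewrite /hilb_diff2 /diff_op !addrK.
have -> : h (i + 1) s' = n by apply: hilb_full; nia.
have -> : h i s' = n by apply: hilb_full; nia.
have -> : h (i - 1) s' = n by apply: hilb_full; nia.
have -> : h (i + 1) (s' - 1) = n by apply: hilb_full; nia.
have -> : h i (s' - 1) = n by apply: hilb_full; nia.
have -> : h (i - 1) (s' - 1) = n by apply: hilb_full; nia.
have -> : h (i + 1) (s' - 1 - 1) = n by apply: hilb_full; nia.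
have -> : h i (s' - 1 - 1) = n by apply: hilb_full; nia.
by have := hilb_le (i - 1) (s' - 1 - 1); move: (h _ _) n => m N; lia.
Qed.

Lemma hilb_diff2_column s : i + 1 < s -> hilb_diff2 X s (i' + 1) <= 0.
Proof.
move=> hs; rewrite /hilb_diff2 /diff_op !addrK.
have -> : h s (i' + 1) = n by apply: hilb_full; nia.
have -> : h s i' = n by apply: hilb_full; nia.
have -> : h s (i' - 1) = n by apply: hilb_full; nia.
have -> : h (s - 1) (i' + 1) = n by apply: hilb_full; nia.
have -> : h (s - 1) i' = n by apply: hilb_full; nia.
have -> : h (s - 1) (i' - 1) = n by apply: hilb_full; nia.
have -> : h (s - 1 - 1) (i' + 1) = n by apply: hilb_full; nia.
have -> : h (s - 1 - 1) i' = n by apply: hilb_full; nia.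
by have := hilb_le (s - 1 - 1) (i' - 1); move: (h _ _) n => m N; lia.
Qed.

End CornerEntry.

(** * The length of the virtual resolution *)

Theorem theorem1p4 (k : closedFieldType) (n : nat) (n_ge2 : (2 <= n)%N)
    (U : n.-tuple (P1xP1 k) -> Prop) (hU : general_position_locus U)
    (X : n.-tuple (P1xP1 k)) (X_uniq : uniq X) (X_general : U X)
    (i i' : int) (i_min : minimal_regular (coord_ring X) (i, i'))
    (i_le : i <= i')
    (h1 : n%:Z < i * (i' + 2))
    (h2 : 3 * n%:Z - 3 * i * i' - 2 * i - 2 * i' < 0)
    (F : gcomplex k) (F_res : min_free_res F (coord_ring X)) :
  has_length (vres F (i, i')) 3.
Proof.
have [_ _ /(_ X X_general)[gX bX]] := hU.
have sX : size X = n by rewrite size_tuple.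
rewrite -{}sX in n_ge2 h1 h2.
have [i1 b1 b2] := minimal_regular_bounds X_uniq gX n_ge2 i_min i_le h1.
have d_lt0 : hilb_diff2 X (i + 1) (i' + 1) < 0 by rewrite hilb_diff2_corner.
have beta1 : betti F 1 (i + 1, i' + 1) = 0%N.
  apply: (bX F F_res (i + 1) (i' + 1)).2 => -[_ [[s' [hs]]|[s [hs]]]].
    by rewrite ltNge (hilb_diff2_row X_uniq gX i1 i_le b1 b2 h1).
  by rewrite ltNge (hilb_diff2_column X_uniq gX i1 i_le b1 b2 h1).
have beta3 : (0 < betti F 3 (i + 1, i' + 1)%R)%N.
  have n0 : (0 < size X)%N by apply: leq_trans n_ge2.
  by move: d_lt0; rewrite (hilb_diff2_betti _ _ X_uniq gX n0 F_res) beta1;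
     move: (betti F 0 _) (betti F 2 _) (betti F 3 _) => c0 c2 c3; lia.
split.
  have /card_gt0P[a /eqP da] := beta3.
  have ha : lez2 (gdeg a) ((i, i') + (1, 1)) by rewrite da /lez2 /= !lexx.
  by apply/card_gt0P; exists (Sub a ha).
move=> [|[|[|[|p]]]] // _; apply: eq_card0 => a.
by have /card0_eq/(_ (val a)) := gen_empty F_res p; rewrite inE.
Qed.
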